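(* The assignment $X\mapsto W_X$ is a (natural) one-to-one correspondence between quasi-trigonometric solutions $X$ of the classical Yang-Baxter equation and linear subspaces $W$ of $\mathfrak g((u^{-1}))\oplus\mathfrak g$ such that 1) $W$ is a Lie subalgebra of $\mathfrak g((u^{-1}))\oplus\mathfrak g$ and $W\supseteq u^{-N}\mathfrak g[[u^{-1}]]$ for some $N>0$; 2) $W\oplus V_0=\mathfrak g((u^{-1}))\oplus\mathfrak g$; 3) $W$ is a Lagrangian subspace with respect to the bilinear form $Q$ on $\mathfrak g((u^{-1}))\oplus\mathfrak g$.
   Context: $\mathfrak g$ is a simple complex finite-dimensional Lie algebra, $K$ its Killing form, $\Omega\in\mathfrak g\otimes\mathfrak g$ the quadratic Casimir element with respect to $K$. A quasi-trigonometric solution is a function $X(u,v)=\frac{v\Omega}{u-v}+p(u,v)$, with $p(u,v)$ a polynomial in $u,v$ with coefficients in $\mathfrak g\otimes\mathfrak g$, satisfying the classical Yang-Baxter equation (CYBE), i.e. the two equations $$[X^{12}(u_1,u_2),X^{13}(u_1,u_3)]+[X^{12}(u_1,u_2),X^{23}(u_2,u_3)]+[X^{13}(u_1,u_3),X^{23}(u_2,u_3)]=0,\qquad X^{12}(u,v)=-X^{21}(v,u).$$ $\mathfrak g((u^{-1}))=\mathfrak g\otimes\mathbb C((u^{-1}))$, $\mathfrak g[[u^{-1}]]=\mathfrak g\otimes\mathbb C[[u^{-1}]]$, $\mathfrak g[u]=\mathfrak g\otimes\mathbb C[u]$. The direct sum of Lie algebras $\mathfrak g((u^{-1}))\oplus\mathfrak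 g$ carries the invariant bilinear form $$Q((f(u),a),(g(u),b))=K(f(u),g(u))_0-K(a,b),$$ where the index $0$ means the free term (coefficient of $u^0$) of the series. A subspace is Lagrangian if it equals its own orthogonal complement. The subspace $u^{-N}\mathfrak g[[u^{-1}]]$ is regarded as contained in the first summand. $\mathfrak g[u]$ is embedded by $a(u)\mapsto(a(u),a(0))$ and identified with its image $V_0=\{(a(u),a(0)):a(u)\in\mathfrak g[u]\}$. The correspondence: fix a Cartan subalgebra $\mathfrak h$, a system of positive roots with Borel subalgebras $\mathfrak b_\pm$, and root vectors with $K(e_\alpha,e_{-\alpha})=1$. Let $r_0=\frac12\left(\sum_{\alpha>0}e_\alpha\wedge e_{-\alpha}+\Omega\right)$ with $x\wedge y=x\otimes y-y\otimes x$, and $$W_0=\{(a+f,b): f\in u^{-1}\mathfrak g[[u^{-1}]],\ a\in\mathfrak b_+,\ b\in\mathfrak b_-,\ a_{\mathfrak h}+b_{\mathfrak h}=0\},$$ where $a_{\mathfrak h}$ is the Cartan part of $a$. For $X=\frac{v\Omega}{u-v}+p(u,v)$, regard $r(u,v)=p(u,v)-r_0$ as an element $\sum_s x_s\otimes y_s$ of $\mathfrak g[u]\otimes\mathfrak g[v]\cong V_0\otimes V_0$, let $\Phi(r):W_0\to V_0$, $\Phi(r)(w_0)=\sum_s Q(w_0,y_s)\,x_s$, and put $W_X=\{w_0+\Phi(r)(w_0):w_0\in W_0\}$. *)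

(* Defs.v *)
From HB Require Import structures.
From mathcomp Require Export all_boot all_order all_algebra.
From mathcomp Require Export complex.
From mathcomp Require Export all_classical reals.

Set Implicit Arguments.
Unset Strict Implicit.
Unset Printing Implicit Defensive.

Import Order.TTheory GRing.Theory Num.Theory passmx.

Local Open Scope classical_set_scope.
Local Open Scope ring_scope.

HB.mixin Record Vector_isLieAlgebra (F : fieldType) (g : Type)
    of Vector F g := {
  lie : g -> g -> g;
  lie_linearl : forall y : g, linear (fun x : g => lie x y);
  lie_linearr : forall x : g, linear (lie x);
  liexx : forall x : g, lie x x = 0;
  lie_jacobi : forall x y z : g,
    lie x (lie y z) + lie y (lie z x) + lie z (lie x y) = 0
}.

#[short(type="lieAlgType")]
HB.structure Definition LieAlgebra (F : fieldType) :=
  {g of Vector_isLieAlgebra F g & Vector F g}.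

Section LieAlgebras.
Variables (F : fieldType) (g : lieAlgType F).

Lemma lie0x (y : g) : lie 0 y = 0.
Proof. by have := lie_linearl y (-1) 0 0; rewrite scaler0 addr0 scaleN1r addNr. Qed.

Lemma liex0 (x : g) : lie x 0 = 0.
Proof. by have := lie_linearr x (-1) 0 0; rewrite scaler0 addr0 scaleN1r addNr. Qed.

Definition simple_lie : Prop :=
  (exists x y : g, lie x y != 0) /\
  (forall U : {vspace g}, (forall x y, y \in U -> lie x y \in U) ->
     U = 0%VS \/ U = fullv).

Definition ad (x : g) : 'End(g) := linfun (lie x).

Definition killing (x y : g) : F :=
  \tr (mxof (vbasis {:g}) (vbasis {:g}) (ad x \o ad y)%VF).

(* Cartan subalgebras of a semisimple Lie algebra: H is maximal abelian (that
   is, abelian and equal to its centralizer) and consists of elements h with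
   ad h diagonalizable *)
Definition cartan_subalgebra (H : {vspace g}) : Prop :=
  [/\ forall x y, x \in H -> y \in H -> lie x y = 0,
      forall x, (forall h, h \in H -> lie h x = 0) -> x \in H
    & forall h, h \in H ->
        diagonalizable (mxof (vbasis {:g}) (vbasis {:g}) (ad h))].

Definition cartan_dual (H : {vspace g}) := 'Hom(subvs_of H, F^o).

(* {x | [h, x] = a(h) x for all h in H}, tested on a basis of H *)
Definition root_space (H : {vspace g}) (a : cartan_dual H) : {vspace g} :=
  (\bigcap_(i < \dim H)
     leigenspace (ad (vbasis H)`_i) (a (vsproj H (vbasis H)`_i)))%VS.

Definition is_root (H : {vspace g}) (a : cartan_dual H) : bool :=
  (a != 0) && (root_space a != 0%VS).

Definition positive_system (H : {vspace g}) (pos : seq (cartan_dual H)) : Prop :=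
  [/\ uniq pos,
      forall a, a \in pos -> is_root a,
      forall a, is_root a -> (a \in pos) (+) (- a \in pos)
    & forall a b, a \in pos -> b \in pos -> is_root (a + b) -> a + b \in pos].

Definition root_vectors (H : {vspace g}) (e : cartan_dual H -> g) : Prop :=
  forall a, is_root a -> e a \in root_space a /\ killing (e a) (e (- a)) = 1.

Definition borel_pos (H : {vspace g}) (pos : seq (cartan_dual H)) : {vspace g} :=
  (H + \sum_(a <- pos) root_space a)%VS.

Definition borel_neg (H : {vspace g}) (pos : seq (cartan_dual H)) : {vspace g} :=
  (H + \sum_(a <- pos) root_space (- a))%VS.

(* projection onto H along the sum of all root spaces *)
Definition cartan_part (H : {vspace g}) (pos : seq (cartan_dual H)) : 'End(g) :=
  daddv_pi H (\sum_(a <- pos) (root_space a + root_space (- a)))%VS.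

End LieAlgebras.

(* g (x) g and g (x) g (x) g in coordinates: t : tensor2 g stands for
   \sum_(i, j) t i j e_i (x) e_j, with e the basis vbasis fullv of g *)
Section Tensors.
Variables (F : fieldType) (g : lieAlgType F).
Local Notation n := (\dim {:g}).
Local Notation e := (vbasis {:g}).

Definition tensor2 := 'M[F]_n.
Definition tensor3 := {ffun 'I_n * 'I_n * 'I_n -> F^o}.

Definition tens2 (x y : g) : tensor2 := \matrix_(i, j) (coord e i x * coord e j y).

Definition tens3 (x y z : g) : tensor3 :=
  [ffun ijk => coord e ijk.1.1 x * coord e ijk.1.2 y * coord e ijk.2 z].

Definition wedge (x y : g) : tensor2 := tens2 x y - tens2 y x.

(* the basis of g dual to e with respect to the Killing form *)
Definition dual_basis (i : 'I_n) : g :=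
  \sum_(j < n) invmx (\matrix_(k, l) killing (e`_k) (e`_l)) i j *: e`_j.

Definition casimir : tensor2 := \sum_(i < n) tens2 e`_i (dual_basis i).

Definition lie12_13 (s t : tensor2) : tensor3 :=
  \sum_(i < n) \sum_(j < n) \sum_(k < n) \sum_(l < n)
    (s i j * t k l) *: tens3 (lie e`_i e`_k) e`_j e`_l.

Definition lie12_23 (s t : tensor2) : tensor3 :=
  \sum_(i < n) \sum_(j < n) \sum_(k < n) \sum_(l < n)
    (s i j * t k l) *: tens3 e`_i (lie e`_j e`_k) e`_l.

Definition lie13_23 (s t : tensor2) : tensor3 :=
  \sum_(i < n) \sum_(j < n) \sum_(k < n) \sum_(l < n)
    (s i j * t k l) *: tens3 e`_i e`_k (lie e`_j e`_l).

Definition CYBE (X : F -> F -> tensor2) : Prop :=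
  (forall u1 u2 u3, u1 != u2 -> u1 != u3 -> u2 != u3 ->
     lie12_13 (X u1 u2) (X u1 u3) + lie12_23 (X u1 u2) (X u2 u3)
     + lie13_23 (X u1 u3) (X u2 u3) = 0) /\
  (forall u v, u != v -> X u v = - (X v u)^T).

(* polynomials in u, v with coefficients in g (x) g: the coefficient of
   u^k v^l is \matrix_(i, j) (p i j)`_l`_k *)
Definition tpoly := 'M[{poly {poly F}}]_n.

Definition tpoly_eval (p : tpoly) (u v : F) : tensor2 :=
  map_mx (fun q : {poly {poly F}} => q.[v%:P].[u]) p.

(* the function v Omega / (u - v) + p(u, v); as (u - v)^-1 = 0 for u = v, its
   values on the diagonal are those of p and carry no extra information *)
Definition quasi_trig (p : tpoly) (u v : F) : tensor2 :=
  (v / (u - v)) *: casimir + tpoly_eval p u v.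

Definition quasi_trig_solution (X : F -> F -> tensor2) : Prop :=
  (exists p : tpoly, X = quasi_trig p) /\ CYBE X.

(* the polynomial p with X = quasi_trig p, which is unique when F is infinite
   (and 0 when there is none) *)
Definition poly_part (X : F -> F -> tensor2) : tpoly :=
  xget 0 [set p : tpoly | X = quasi_trig p].

Definition r0 (H : {vspace g}) (pos : seq (cartan_dual H)) (ev : cartan_dual H -> g) :
    tensor2 :=
  2%:R^-1 *: (\sum_(a <- pos) wedge (ev a) (ev (- a)) + casimir).

End Tensors.

(* V((u^-1)): f k is the coefficient of u^k, zero for all large k *)
Section Laurent.
Variables (F : fieldType) (V : lmodType F).

Definition bounded_above : {pred int -> V} :=
  fun f => `[< exists N : int, forall k, N < k -> f k = 0 >].

Record laurent := Laurent {
  lcoef :> int -> V;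
  lcoefP : lcoef \in bounded_above
}.

HB.instance Definition _ := [isSub of laurent for lcoef].
HB.instance Definition _ := [Choice of laurent by <:].

Lemma bounded_above_submod : submod_closed bounded_above.
Proof.
split=> [|c f h /asboolP[N Nf] /asboolP[M Mh]]; first by apply/asboolP; exists 0.
apply/asboolP; exists (Num.max N M) => k; rewrite gt_max => /andP[Nk Mk].
have -> : (c *: f + h) k = c *: f k + h k by [].
by rewrite Nf// Mh// scaler0 addr0.
Qed.

HB.instance Definition _ :=
  GRing.isSubmodClosed.Build F (int -> V) bounded_above bounded_above_submod.
HB.instance Definition _ := [SubChoice_isSubLmodule of laurent by <:].

Lemma monom_subproof (x : V) (k : nat) :
  (fun m : int => if m == k%:Z then x else 0) \in bounded_above.
Proof. by apply/asboolP; exists k%:Z => m /gt_eqF->. Qed.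

Definition monom (x : V) (k : nat) : laurent := Laurent (monom_subproof x k).

(* the coefficient of u^k in b(f(u), h(u)), b extended to series by
   bilinearity; only finitely many terms of the sum are nonzero *)
Definition cauchy_coef (U : nmodType) (b : V -> V -> U) (f h : int -> V)
    (k : int) : U :=
  \sum_(i \in [set: int]) b (f i) (h (k - i)).

End Laurent.

Section Double.
Variables (F : fieldType) (g : lieAlgType F).

Lemma llie_subproof (f h : laurent g) :
  cauchy_coef (@lie F g) f h \in @bounded_above F g.
Proof.
have /asboolP[N Nf] := lcoefP f; have /asboolP[M Mh] := lcoefP h.
apply/asboolP; exists (N + M) => k NMk; apply: fsbig1 => i _.
have [Ni|iN] := ltP N i; first by rewrite Nf// lie0x.
rewrite Mh ?liex0// ltrBrDr (le_lt_trans _ NMk)// addrC lerD2r//.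
Qed.

Definition llie (f h : laurent g) : laurent g := Laurent (llie_subproof f h).

(* g((u^-1)) (+) g *)
Definition loop_double := (laurent g * g)%type.

Definition double_lie (w z : loop_double) : loop_double := (llie w.1 z.1, lie w.2 z.2).

Definition Q (w z : loop_double) : F :=
  cauchy_coef (@killing F g) w.1 z.1 0 - killing w.2 z.2.

Definition lie_subalgebra (W : set loop_double) : Prop :=
  submod_closed [in W] /\ (forall w z, W w -> W z -> W (double_lie w z)).

(* u^-N g[[u^-1]], in the first summand *)
Definition tail (N : nat) : set loop_double :=
  [set w : loop_double | (forall k : int, - N%:Z < k -> w.1 k = 0) /\ w.2 = 0].

Definition lagrangian (W : set loop_double) : Prop :=
  W = [set w | forall z, W z -> Q w z = 0].

Definition complementary (W V : set loop_double) : Prop :=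
  W `&` V = [set 0] /\ [set w + v | w in W & v in V] = setT.

Definition diag_embed (f : laurent g) : loop_double := (f, f 0).

Definition V0 : set loop_double :=
  [set diag_embed f | f in [set f : laurent g | forall k, k < 0 -> f k = 0]].

Definition W0 (H : {vspace g}) (pos : seq (cartan_dual H)) : set loop_double :=
  [set w : loop_double | [/\ forall k : int, 0 < k -> w.1 k = 0,
               w.1 0 \in borel_pos pos,
               w.2 \in borel_neg pos
             & cartan_part pos (w.1 0) + cartan_part pos w.2 = 0]].

Local Notation n := (\dim {:g}).
Local Notation e := (vbasis {:g}).

(* r is written as the sum of the pure tensors
   (r i j)`_l`_k (e_i u^k) (x) (e_j v^l) *)
Definition Phi (r : tpoly g) (w : loop_double) : loop_double :=
  \sum_(i < n) \sum_(j < n)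
    \sum_(l < size (r i j)) \sum_(k < size (r i j)`_l)
      ((r i j)`_l`_k * Q w (diag_embed (monom e`_j l)))
        *: diag_embed (monom e`_i k).

Definition W_of (H : {vspace g}) (pos : seq (cartan_dual H)) (ev : cartan_dual H -> g)
    (X : F -> F -> tensor2 g) : set loop_double :=
  let r := poly_part X - map_mx (fun c : F => c%:P%:P) (r0 pos ev) in
  [set w + Phi r w | w in W0 pos].

End Double.

Arguments V0 {F g}.
Arguments tail {F g} N.

(* Main.v *)
From HB Require Import structures.
Require Import Defs.
From mathcomp Require Import ring zify.

(* Let y_l(w) in g be the coefficients through which w pairs with V0, that is
   Q(w, x u^l) = K(y_l(w), x), and let p_kl in g (x) g act on g through K and its
   second leg.  As the root spaces are one-dimensional, W0 is the set of w without
   positive powers of u such that [u^0] w = r0 y_0(w); so r0 cancels in W_X, and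
     W_X = {w | for all k >= 0, [u^k] w = sum_l p_kl y_l(w)}.
   Hence W_X is parametrized by arbitrary sequences (y_l), is complementary to V0 and
   determines p; conversely the p_kl can be read off any W with the three properties.

   The elements w(v, y) of W_X with y_l = v^l y are the expansions at u = oo of the
   contraction of X(u, v) with y.  Every condition Q(w, z) = 0 for w in W_X follows from
   its instances w = w(v, y), because it is polynomial in v.  Moreover
   Q(w(u, x), w(v, y)) is the pairing of X(u, v) + X(v, u)^21 with x (x) y and, by
   partial fractions, Q([w1, w2], w3) for wi = w(ui, yi) is the pairing of the left-hand
   side of the Yang-Baxter equation with y1 (x) y2 (x) y3.  So the two equations say
   that W_X is isotropic and closed under the bracket. *)

Set Implicit Arguments.
Unset Strict Implicit.
Unset Printing Implicit Defensive.

Import Order.TTheory GRing.Theory Num.Theory passmx.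

Local Open Scope classical_set_scope.
Local Open Scope ring_scope.

(** * Killing form *)

Arguments killing : simpl never.

(** The second summand g records values at u = 0: v y / (u - v) gives the pair formed by its
    expansion at u = oo and its value -y at 0. For rational functions Q is then the sum of the
    residues of K(f, g) du / u away from 0 and oo, and this is how the poles at u_i produce the
    Yang-Baxter terms. An element w is handled through its nonnegative coefficients and the y_l(w).
    Since V0 is the locus y = 0, a complement of V0 is the graph of a map from sequences y to V0;
    containing a tail makes this map depend on finitely many y_l, that is, makes its kernel a
    polynomial. The Yang-Baxter equation is imposed at distinct points only, so every density
    argument must tolerate a finite set of excluded points. Its pairing with three vectors matches
    Q([w1, w2], w3) only for skew-symmetric X, so isotropy is settled before closure under the
    bracket. Nondegeneracy of K comes from the root vectors rather than from Cartan's criterion, and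
    diagonalizability of ad h on H stands in for algebraic closure; thus the argument runs over any
    [numFieldType]. *)

Section LieBasics.
Variables (F : fieldType) (g : lieAlgType F).
Implicit Types x y z : g.

HB.instance Definition _ x := GRing.isLinear.Build F g g *:%R (lie x) (lie_linearr x).

Lemma lieDl x y z : lie (x + y) z = lie x z + lie y z.
Proof. by have := lie_linearl z 1 x y; rewrite !scale1r. Qed.

Lemma lieZl c x y : lie (c *: x) y = c *: lie x y.
Proof. by have := lie_linearl y c x 0; rewrite lie0x !addr0. Qed.

Lemma lieC x y : lie x y = - lie y x.
Proof.
apply/eqP; rewrite -addr_eq0; have := liexx (x + y).
by rewrite lieDl !linearD/= !liexx add0r addr0 => ->.
Qed.

Lemma lieNl x y : lie (- x) y = - lie x y.
Proof. by rewrite -scaleN1r lieZl scaleN1r. Qed.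

Lemma lie_suml (I : Type) (r : seq I) (P : pred I) (f : I -> g) y :
  lie (\sum_(i <- r | P i) f i) y = \sum_(i <- r | P i) lie (f i) y.
Proof. by rewrite lieC linear_sum -sumrN; apply: eq_bigr => i _; rewrite -lieC. Qed.

Lemma lie_lie x y z : lie (lie x y) z = lie x (lie y z) - lie y (lie x z).
Proof.
have := lie_jacobi x y z; rewrite [lie z (lie x y)]lieC [lie z x]lieC linearN/=.
by move/eqP; rewrite subr_eq0 => /eqP.
Qed.

Local Notation n := (\dim {:g}).
Local Notation e := (vbasis {:g}).
Local Notation e_basis := (vbasisP {:g}).

Definition ad_mx x : 'M[F]_n := mxof e e (ad x).

Lemma adE x y : ad x y = lie x y. Proof. by rewrite lfunE. Qed.

Lemma ad_mx_linear : linear ad_mx.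
Proof.
move=> c x y; rewrite /ad_mx -linearP; congr mxof; apply/lfunP => z.
by rewrite add_lfunE scale_lfunE !adE lieDl lieZl.
Qed.

HB.instance Definition _ := GRing.isLinear.Build F g 'M[F]_n *:%R ad_mx ad_mx_linear.

(** Matrices act on row vectors here, so composition is reversed and the commutator changes sign. *)
Lemma ad_mx_lie x y : ad_mx (lie x y) = ad_mx y *m ad_mx x - ad_mx x *m ad_mx y.
Proof.
rewrite /ad_mx -!(mxof_comp _ _ e_basis) -linearB; congr mxof; apply/lfunP => z.
by rewrite add_lfunE opp_lfunE !comp_lfunE !adE lie_lie.
Qed.

Lemma rVof_lie x y : rVof e (lie x y) = rVof e y *m ad_mx x.
Proof. by rewrite -(rVof_app _ e_basis) adE. Qed.

Lemma killingE x y : killing x y = \tr (ad_mx y *m ad_mx x).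
Proof. by rewrite /killing (mxof_comp _ _ e_basis). Qed.

Lemma killingC x y : killing x y = killing y x.
Proof. by rewrite !killingE mxtrace_mulC. Qed.

Lemma killing_linear x : linear (killing x : g -> F^o).
Proof. by move=> c y z; rewrite !killingE linearP mulmxDl -scalemxAl linearP. Qed.

HB.instance Definition _ x := GRing.isLinear.Build F g F^o *:%R
  (killing x : g -> F^o) (killing_linear x).

Lemma killing0r x : killing x 0 = 0. Proof. exact: linear0. Qed.
Lemma killingDr x y z : killing x (y + z) = killing x y + killing x z.
Proof. exact: linearD. Qed.
Lemma killingNr x y : killing x (- y) = - killing x y.
Proof. exact: linearN. Qed.
Lemma killingZr c x y : killing x (c *: y) = c * killing x y.
Proof. exact: linearZ. Qed.
Lemma killing_sumr (I : Type) (r : seq I) (P : pred I) (f : I -> g) x :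
  killing x (\sum_(i <- r | P i) f i) = \sum_(i <- r | P i) killing x (f i).
Proof. exact: linear_sum. Qed.

Lemma killing0l x : killing 0 x = 0. Proof. by rewrite killingC killing0r. Qed.
Lemma killingDl x y z : killing (x + y) z = killing x z + killing y z.
Proof. by rewrite killingC killingDr ![killing z _]killingC. Qed.
Lemma killingNl x y : killing (- x) y = - killing x y.
Proof. by rewrite killingC killingNr killingC. Qed.
Lemma killingZl c x y : killing (c *: x) y = c * killing x y.
Proof. by rewrite killingC killingZr killingC. Qed.
Lemma killing_suml (I : Type) (r : seq I) (P : pred I) (f : I -> g) x :
  killing (\sum_(i <- r | P i) f i) x = \sum_(i <- r | P i) killing (f i) x.
Proof. by rewrite killingC killing_sumr; apply: eq_bigr => i _; rewrite killingC. Qed.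

Lemma killing_lie x y z : killing (lie x y) z = killing x (lie y z).
Proof.
rewrite !killingE !ad_mx_lie mulmxBr mulmxBl !linearB/= !mulmxA.
by congr (_ - _); rewrite mxtrace_mulC mulmxA.
Qed.

Definition killing_nondeg := forall x, (forall y, killing x y = 0) -> x = 0.

Lemma killing_radical_ideal x :
  (forall z, killing x z = 0) -> forall y z, killing (lie y x) z = 0.
Proof. by move=> x0 y z; rewrite lieC killingNl killing_lie x0 oppr0. Qed.

(** The radical of K is an ideal, hence 0 or g, and one nonzero value of K excludes g. It is written
    as the kernel of a linear map to have it as a [vspace]. *)
Lemma simple_killing_nondeg : simple_lie g ->
  (exists x y : g, killing x y != 0) -> killing_nondeg.
Proof.
move=> [_ simpl] [x0 [y0 xy0]].
have f_lin : linear (fun x => \row_j killing x e`_j : 'rV[F]_n).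
  by move=> c x y; apply/rowP => j; rewrite !mxE killingDl killingZl.
pose fL := GRing.isLinear.Build F g 'rV[F]_n *:%R _ f_lin.
pose fl : {linear g -> 'rV[F]_n} := HB.pack (fun x => \row_j killing x e`_j : 'rV[F]_n) fL.
have kerP x : (x \in lker (linfun fl)) <-> forall y, killing x y = 0.
  rewrite memv_ker lfunE/=; split=> [/eqP/rowP xe y|x0'].
    rewrite (coord_basis e_basis (memvf y)) killing_sumr big1// => i _.
    by rewrite killingZr; have := xe i; rewrite !mxE => ->; rewrite mulr0.
  by apply/eqP/rowP => i; rewrite !mxE.
have [|k0|kT] := simpl (lker (linfun fl)).
- by move=> x y /kerP ?; apply/kerP => z; exact: killing_radical_ideal.
- by move=> x /kerP; rewrite k0 memv0 => /eqP.
- by case/eqP: xy0; have /kerP : x0 \in lker (linfun fl) by rewrite kT memvf.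
Qed.

End LieBasics.

(** * Root decomposition *)

Lemma memv_sum_ind (F : fieldType) (vT : vectType F) (I : eqType) (s : seq I)
    (U : I -> {vspace vT}) (P : vT -> Prop) :
  P 0 -> (forall x y, P x -> P y -> P (x + y)) ->
  (forall i x, i \in s -> x \in U i -> P x) ->
  forall x, x \in (\sum_(i <- s) U i)%VS -> P x.
Proof.
move=> P0 PD; elim: s => [|i s IHs] PU x.
  by rewrite big_nil memv0 => /eqP ->.
rewrite big_cons => /memv_addP[y yU [z zU ->]]; apply: PD.
  by apply: PU yU; rewrite mem_head.
by apply: IHs zU => j t js; apply: PU; rewrite inE js orbT.
Qed.

Lemma memv_sum_seq (F : fieldType) (vT : vectType F) (I : eqType) (s : seq I)
    (U : I -> {vspace vT}) i x :
  i \in s -> x \in U i -> x \in (\sum_(i <- s) U i)%VS.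
Proof.
elim: s => // j s IHs; rewrite inE big_cons => /predU1P[-> xU|/IHs{}IHs /IHs xU].
  by rewrite -[x]addr0 memv_add ?mem0v.
by rewrite -[x]add0r memv_add ?mem0v.
Qed.

(* On each eigenspace of T the trace of [A, B] is zero, so the eigenvalue is. *)
Lemma diagonalizable_commutator_eq0 (F : numFieldType) n (T A B : 'M[F]_n) :
  diagonalizable T -> T = A *m B - B *m A -> T *m A = A *m T -> T = 0.
Proof.
case=> P Pu /similar_diagPex [d /(similarLR Pu)]; rewrite conjVmx// => TE TAB TA.
set A' := P *m A *m invmx P; set B' := P *m B *m invmx P.
have PV := mulVmx Pu.
have dE : diag_mx d = A' *m B' - B' *m A'.
  have -> : diag_mx d = P *m T *m invmx P.
    by rewrite TE !mulmxA mulmxV// mul1mx -mulmxA mulmxV// mulmx1.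
  rewrite TAB mulmxBr mulmxBl /A' /B' !mulmxA; congr (_ - _).
    by rewrite -[P *m A *m _ *m _]mulmxA PV mulmx1.
  by rewrite -[P *m B *m _ *m _]mulmxA PV mulmx1.
have dA : diag_mx d *m A' = A' *m diag_mx d.
  have -> : diag_mx d = P *m T *m invmx P.
    by rewrite TE !mulmxA mulmxV// mul1mx -mulmxA mulmxV// mulmx1.
  rewrite /A' !mulmxA -[P *m T *m _ *m _]mulmxA PV mulmx1 -[P *m T *m A]mulmxA TA.
  by rewrite -[P *m A *m _ *m _]mulmxA PV mulmx1 !mulmxA.
(* [A'] commutes with the diagonal matrix, so it preserves each of its eigenspaces. *)
have A0 i j : d 0 i != d 0 j -> A' i j = 0.
  move=> dij; have /matrixP/(_ i j) := dA; rewrite mul_diag_mx mul_mx_diag !mxE => /eqP.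
  by rewrite mulrC -subr_eq0 -mulrBr mulf_eq0 subr_eq0 (negPf dij) orbF => /eqP.
have d0 : d = 0.
  apply/rowP => k; rewrite mxE; apply/eqP; apply/negP => /negP dk.
  have : \sum_(i | d 0 i == d 0 k) d 0 i = 0.
    rewrite (eq_bigr (fun i => \sum_(j | d 0 j == d 0 k) A' i j * B' j i
             - \sum_(j | d 0 j == d 0 k) B' i j * A' j i)); last first.
      move=> i /eqP di; have /matrixP/(_ i i) := dE; rewrite !mxE eqxx mulr1n => ->.
      congr (_ - _).
        rewrite (bigID (fun j => d 0 j == d 0 k))/= [X in _ + X]big1 ?addr0// => j dj.
        by rewrite A0 ?mul0r// di eq_sym.
      rewrite (bigID (fun j => d 0 j == d 0 k))/= [X in _ + X]big1 ?addr0// => j dj.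
      by rewrite A0 ?mulr0// di.
    rewrite sumrB exchange_big/=; apply/eqP; rewrite subr_eq0; apply/eqP.
    by apply: eq_bigr => i _; apply: eq_bigr => j _; rewrite mulrC.
  (* The trace on the eigenspace is [d 0 k] times its dimension, which is positive as k itself is
     counted. *)
  rewrite (eq_bigr (fun=> d 0 k)) => [|i /eqP//]; rewrite sumr_const => /eqP.
  rewrite mulrn_eq0 (negPf dk) orbF => /eqP/card0_eq/(_ k).
  by change ((d 0 k == d 0 k) = false -> False); rewrite eqxx.
by rewrite TE d0 linear0 mulmx0 mul0mx.
Qed.

(** Otherwise T would have the n + 1 distinct eigenvalues c, 2c, ..., (n + 1)c. This ends the chain
    of vectors in [root_line]. *)
Lemma no_eigenvalue_seq (F : numFieldType) n (T : 'M[F]_n) (v : nat -> 'rV[F]_n) (c : F) :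
  c != 0 -> (forall k, v k *m T = (k.+1%:R * c) *: v k) -> exists k, v k = 0.
Proof.
move=> c0 vT; apply: contrapT => nv.
have ev k : eigenvalue T (k.+1%:R * c).
  by apply/eigenvalueP; exists (v k) => //; apply/eqP => v0; apply: nv; exists k.
pose s := [seq k.+1%:R * c | k <- iota 0 n.+1].
have := max_poly_roots (monic_neq0 (char_poly_monic T)) (_ : all (root (char_poly T)) s) _.
rewrite size_char_poly size_map size_iota ltnn => H; apply: notF; apply: H.
  by apply/allP => _ /mapP[k _ ->]; rewrite -eigenvalue_root_char.
rewrite map_inj_uniq ?iota_uniq// => i j /(mulIf c0)/eqP.
by rewrite eqr_nat eqSS => /eqP.
Qed.

Section Roots.
Variables (F : numFieldType) (g : lieAlgType F) (H : {vspace g}).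
Implicit Types (x y z h : g) (a b : cartan_dual H).
Local Notation n := (\dim {:g}).
Local Notation e := (vbasis {:g}).
Local Notation e_basis := (vbasisP {:g}).

(** [vsproj] extends a to all of g, which spares membership proofs; only the values on H are
    meaningful. *)
Definition weight a h : F := a (vsproj H h).

Lemma weight_linear a : linear (weight a : g -> F^o).
Proof. by move=> c x y; rewrite /weight !linearP. Qed.

HB.instance Definition _ a := GRing.isLinear.Build F g F^o *:%R
  (weight a : g -> F^o) (weight_linear a).

Lemma weightZ a c h : weight a (c *: h) = c * weight a h.
Proof. exact: linearZ. Qed.

Lemma weightD a b h : weight (a + b) h = weight a h + weight b h.
Proof. by rewrite /weight add_lfunE. Qed.

Lemma weightN a h : weight (- a) h = - weight a h.
Proof. by rewrite /weight opp_lfunE. Qed.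

Lemma weight_neq0 a : a != 0 -> exists2 h, h \in H & weight a h != 0.
Proof.
move=> a0; apply: contrapT => na; case/eqP: a0; apply/lfunP => s.
rewrite zero_lfunE; apply/eqP; apply/negP => /negP as0.
by apply: na; exists (vsval s); rewrite ?subvsP// /weight vsvalK.
Qed.

Lemma root_spaceP a x :
  x \in root_space a <-> forall h, h \in H -> lie h x = weight a h *: x.
Proof.
rewrite memvE; split=> [/subv_bigcapP xa h hH|xa].
  have xb (i : 'I_(\dim H)) : lie (vbasis H)`_i x = weight a (vbasis H)`_i *: x.
    have := xa i isT; rewrite -memvE memv_ker add_lfunE opp_lfunE scale_lfunE id_lfunE.
    by rewrite adE subr_eq0 => /eqP.
  rewrite (coord_vbasis hH) lie_suml linear_sum scaler_suml/=; apply: eq_bigr => i _.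
  by rewrite lieZl xb weightZ scalerA.
apply/subv_bigcapP => i _; rewrite -memvE memv_ker add_lfunE opp_lfunE scale_lfunE id_lfunE.
by rewrite adE xa ?vbasis_mem ?mem_nth ?size_tuple// subrr.
Qed.

Lemma lie_root_space a x h : x \in root_space a -> h \in H -> lie h x = weight a h *: x.
Proof. by move/root_spaceP => xa; exact: xa. Qed.

Lemma root_space0 x : (forall h, h \in H -> lie h x = 0) <-> x \in root_space (0 :
  cartan_dual H).
Proof.
rewrite root_spaceP; split=> x0 h hH.
  by rewrite x0// /weight zero_lfunE scale0r.
by rewrite x0// /weight zero_lfunE scale0r.
Qed.

Lemma root_space_lie a b x y :
  x \in root_space a -> y \in root_space b -> lie x y \in root_space (a + b).
Proof.
move=> /root_spaceP xa /root_spaceP yb; apply/root_spaceP => h hH.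
have := lie_lie h x y; rewrite (xa h)// (yb h)// linearZ/= lieZl => /esym/eqP.
by rewrite subr_eq -scalerDl -weightD => /eqP.
Qed.

(** Invariance of K gives (a + b)(h) K(x, y) = 0 for every h in H. *)
Lemma killing_root_space a b x y : a + b != 0 ->
  x \in root_space a -> y \in root_space b -> killing x y = 0.
Proof.
move=> /weight_neq0[h hH]; rewrite weightD => ab /root_spaceP xa /root_spaceP yb.
apply/eqP; move: (killing_lie h x y); rewrite (xa h)// killingZl.
rewrite [lie x y]lieC killingNr -killing_lie (yb h)// killingZl => /eqP.
rewrite -addr_eq0 [killing y x]killingC -mulrDl mulf_eq0 (negPf ab).
by [].
Qed.

Hypothesis H_cartan : cartan_subalgebra H.

Lemma cartan_root_space0 x : x \in H <-> x \in root_space (0 : cartan_dual H).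
Proof.
case: H_cartan => Hab Hmax _; rewrite -root_space0; split=> [xH h hH|]; first exact: Hab.
exact: Hmax.
Qed.

Lemma killing_cartan_root a x h :
  a != 0 -> h \in H -> x \in root_space a -> killing h x = 0.
Proof.
by move=> a0 /cartan_root_space0 hH; apply: killing_root_space hH; rewrite add0r.
Qed.

(* The commuting ad h, h in H, are simultaneously diagonalizable. *)
Lemma root_space_ind (P : g -> Prop) :
  P 0 -> (forall x y, P x -> P y -> P (x + y)) ->
  (forall h, h \in H -> P h) ->
  (forall a x, is_root a -> x \in root_space a -> P x) -> forall x, P x.
Proof.
move=> P0 PD PH PR x; case: H_cartan => Hab Hmax Hdiag.
pose As := [seq ad_mx h | h <- vbasis H].
have [|Q Qu /allP/= QA] := (codiagonalizableP As).1.
  split.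
    move=> _ _ /mapP[h hb ->] /mapP[k kb ->]; rewrite /comm_mx; apply/eqP.
    by rewrite -subr_eq0 -ad_mx_lie Hab ?linear0 ?vbasis_mem.
  by move=> _ /mapP[h hb ->]; exact/Hdiag/vbasis_mem.
have hq (i : 'I_n) (h : g) : h \in vbasis H ->
    exists c, lie h (vecof e (row i Q)) = c *: vecof e (row i Q).
  move=> hb; have := QA _ (map_f (@ad_mx F g) hb) => /similar_diagPex[d].
  move=> /(similarP Qu) QE; exists (d 0 i).
  apply: (can_inj (rVofK e_basis)).
  by rewrite rVof_lie linearZ/= !(vecofK e_basis) -row_mul QE mul_diag_mx; apply/rowP => j;
    rewrite !mxE.
pose w := vecof e.
have wE (i : 'I_n) : exists a : cartan_dual H, w (row i Q) \in root_space a.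
  have /choice[c cE] : forall j : 'I_(\dim H), exists c,
      lie (vbasis H)`_j (w (row i Q)) = c *: w (row i Q).
    by move=> j; apply: hq; rewrite mem_nth ?size_tuple.
  (* The eigenvalues [c] on the basis of H extend linearly to the weight of this common
     eigenvector. *)
  have f_lin : linear (fun s : subvs_of H => \sum_j coord (vbasis H) j (vsval s) * c j : F^o).
    move=> u s t; rewrite scaler_sumr -big_split/=; apply: eq_bigr => j _.
    by rewrite linearP/= mulrDl -mulrA.
  pose fL := GRing.isLinear.Build F (subvs_of H) F^o *:%R _ f_lin.
  pose fl : {linear subvs_of H -> F^o} :=
    HB.pack (fun s : subvs_of H => \sum_j coord (vbasis H) j (vsval s) * c j : F^o) fL.
  exists (linfun fl); apply/root_spaceP => h hH; rewrite /weight lfunE/= vsprojK//.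
  rewrite {1}(coord_vbasis hH) lie_suml scaler_suml; apply: eq_bigr => j _.
  by rewrite lieZl cE scalerA.
have -> : x = \sum_i (rVof e x *m invmx Q) 0 i *: w (row i Q).
  rewrite -[LHS](rVofK e_basis) -[rVof e x in LHS](mulmxKV Qu).
  by rewrite [in LHS]mulmx_sum_row linear_sum; apply: eq_bigr => i _; rewrite linearZ.
elim/big_ind : _ => // i _; have [a wa] := wE i.
have {}wa : (rVof e x *m invmx Q) 0 i *: w (row i Q) \in root_space a by rewrite memvZ.
move: (_ *: _) wa => y ya.
have [a0|a0] := eqVneq a 0; first by apply/PH/cartan_root_space0; rewrite -a0.
have [->//|y0] := eqVneq y 0.
apply: (PR a) => //; rewrite /is_root a0/=; apply: contraNneq y0 => r0.
by rewrite -memv0 -r0.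
Qed.

Hypothesis g_simple : simple_lie g.
Variable ev : cartan_dual H -> g.
Hypothesis e_root : root_vectors ev.

(** Without roots g would equal H and be abelian. *)
Lemma exists_root : exists a : cartan_dual H, is_root a.
Proof.
apply: contrapT => nr; have [[x [y xy]] _] := g_simple; case: (H_cartan) => Hab _ _.
have gH : forall z, z \in H.
  apply: root_space_ind => [|u v uH vH|//|a u ra]; rewrite ?mem0v ?memvD//.
  by case: nr; exists a.
by case/eqP: xy; exact: Hab.
Qed.

Lemma killing_nondeg_roots : killing_nondeg g.
Proof.
apply: simple_killing_nondeg => //; have [a /e_root[_ ea]] := exists_root.
by exists (ev a), (ev (- a)); rewrite ea oner_neq0.
Qed.

Lemma killing_ext x : (forall h, h \in H -> killing x h = 0) ->
  (forall a y, is_root a -> y \in root_space a -> killing x y = 0) -> x = 0.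
Proof.
move=> xH xR; apply: killing_nondeg_roots; apply: root_space_ind => //.
  by rewrite killing0r.
by move=> y z xy xz; rewrite killingDr xy xz addr0.
Qed.

Lemma root_neq0 a : is_root a -> a != 0. Proof. by case/andP. Qed.

(** If the root space of -a were zero, e_a would be orthogonal to all of g, hence zero, against
    K(e_a, e_(-a)) = 1. Only after this does [root_vectors] place e_(-a) in its root space. *)
Lemma is_rootN a : is_root a -> is_root (- a).
Proof.
move=> ra; have [ea eaN] := e_root ra.
rewrite /is_root oppr_eq0 root_neq0//=; apply/eqP => rN0.
suff e0 : ev a = 0 by move: eaN; rewrite e0 killing0l => /esym/eqP; rewrite oner_eq0.
apply: killing_ext => [h hH|b y rb yb].
  by rewrite killingC (killing_cartan_root _ hH ea)// root_neq0.
have [ab|ab] := eqVneq (a + b) 0; last exact: killing_root_space ab ea yb.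
have bE : b = - a by apply/eqP; rewrite -addr_eq0 addrC ab.
by move: yb; rewrite bE rN0 memv0 => /eqP->; rewrite killing0r.
Qed.

(** * One-dimensionality of the root spaces *)

Section RootString.
Variable a : cartan_dual H.
Hypothesis ra : is_root a.
Let x := ev a.
Let y := ev (- a).
Let t := lie x y.

Let xa : x \in root_space a. Proof. by have [] := e_root ra. Qed.
Let ya : y \in root_space (- a). Proof. by have [] := e_root (is_rootN ra). Qed.
Let xy1 : killing x y = 1. Proof. by have [] := e_root ra. Qed.

Let tH : t \in H.
Proof. by apply/cartan_root_space0; rewrite -(subrr a); exact: root_space_lie. Qed.

Let killing_coroot h : h \in H -> killing h t = weight a h.
Proof.
by move=> hH; rewrite /t -killing_lie (lie_root_space xa)// killingZl xy1 mulr1.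
Qed.

Let lie_tx : lie t x = weight a t *: x. Proof. exact: lie_root_space. Qed.

(** If a(t) = 0, then t commutes with e_(-a), so ad t is a diagonalizable commutator commuting with
    one of its factors and vanishes; but then a(h) = K(h, t) = 0 on H. *)
Let weight_coroot_neq0 : weight a t != 0.
Proof.
apply/eqP => at0; case: (H_cartan) => _ _ /(_ t tH) Hdiag.
have ad_t0 : ad_mx t = 0.
  apply: (diagonalizable_commutator_eq0 (A := ad_mx y) (B := ad_mx x)) => //.
    by rewrite /t ad_mx_lie.
  apply/eqP; rewrite -subr_eq0 -ad_mx_lie; apply/eqP.
  have := lie_root_space ya tH; rewrite weightN at0 oppr0 scale0r.
  by rewrite lieC => /eqP; rewrite oppr_eq0 => /eqP ->; rewrite linear0.
have [h hH /eqP] := weight_neq0 (root_neq0 ra); apply.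
by rewrite -killing_coroot// killingE ad_t0 mul0mx mxtrace0.
Qed.

(* If z is in the root space of -a and is orthogonal to e_a, then e_a kills z,
   and every vector ad(e_(-a))^k z is nonzero when z is: it is an eigenvector
   of [e_a, e_(-a)], with eigenvalues distinct for distinct k. *)
Lemma root_line z : z \in root_space (- a) -> z = killing (ev a) z *: ev (- a).
Proof.
suff ortho u : u \in root_space (- a) -> killing x u = 0 -> u = 0.
  move=> za; apply/eqP; rewrite -subr_eq0; apply/eqP; apply: ortho.
    by rewrite memvB// memvZ.
  by rewrite killingDr killingNr killingZr -/x -/y xy1 mulr1 subrr.
move=> ua xu0.
(* [e_a, u] lies in H, and K(h, [e_a, u]) = a(h) K(e_a, u) = 0 for h in H. *)
have xu : lie x u = 0.
  have xuH : lie x u \in H.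
    by apply/cartan_root_space0; rewrite -(subrr a); exact: root_space_lie.
  apply: killing_ext => [h hH|b v /root_neq0 b0 vb]; last exact: killing_cartan_root xuH vb.
  by rewrite killingC -killing_lie (lie_root_space xa)// killingZl xu0 mulr0.
pose v k := iter k (lie y) u.
have lie_tv k : lie t (v k) = (k.+1%:R * - weight a t) *: v k.
  elim: k => [|k IHk].
    by rewrite mul1r -weightN; exact: lie_root_space.
  have := lie_lie t y (v k); rewrite IHk linearZ/=.
  have -> : lie t y = - weight a t *: y by rewrite -weightN; exact: lie_root_space.
  rewrite lieZl => /esym/eqP; rewrite subr_eq -scalerDl => /eqP ->.
  by congr (_ *: _); rewrite -[k.+2%:R]natr1 mulrDl mul1r addrC.
(* The binomial is 1 + ... + (k + 1), collected while e_a moves past k + 1 copies of e_(-a). *)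
have lie_xv k : lie x (v k.+1) = ('C(k.+2, 2)%:R * - weight a t) *: v k.
  elim: k => [|k IHk].
    have := lie_lie x y u; rewrite xu linear0 subr0 => <-.
    by have := lie_tv 0%N; rewrite !mul1r.
  have := lie_lie x y (v k.+1); rewrite -/t lie_tv IHk linearZ/= => /esym/eqP.
  rewrite subr_eq -scalerDl => /eqP ->; congr (_ *: _).
  by rewrite -mulrDl -natrD [in RHS]binS bin1 addnC.
have [k vk0] : exists k, v k = 0.
  have [||k k0] := @no_eigenvalue_seq _ _ (ad_mx t) (fun k => rVof e (v k)) (- weight a t).
  - by rewrite oppr_eq0.
  - by move=> k; rewrite -rVof_lie lie_tv linearZ.
  by exists k; apply/eqP; rewrite -(rVof_eq0 e_basis) k0.
(* A zero of the chain propagates down to [v 0], which is u, because the coefficient in [lie_xv] is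
   nonzero. *)
elim: k vk0 => // k IHk vk0; apply: IHk; have := lie_xv k; rewrite vk0 linear0 => /esym/eqP.
rewrite scaler_eq0 mulf_eq0 oppr_eq0 (negPf weight_coroot_neq0) orbF pnatr_eq0.
by rewrite -leqn0 leqNgt bin_gt0 => /eqP.
Qed.

End RootString.

End Roots.

(** * Contractions and the subspace W0 *)

Section Contraction.
Variables (F : fieldType) (g : lieAlgType F).
Implicit Types (s t : tensor2 g) (x y z : g).
Local Notation n := (\dim {:g}).
Local Notation e := (vbasis {:g}).
Local Notation e_basis := (vbasisP {:g}).

(* (1 (x) K(., y)) t *)
Definition contract t y : g := \sum_(i < n) \sum_(j < n) (t i j * killing e`_j y) *: e`_i.

Lemma contract_linear t : linear (contract t).
Proof.
move=> c x y; rewrite /contract scaler_sumr -big_split; apply: eq_bigr => i _ /=.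
rewrite scaler_sumr -big_split; apply: eq_bigr => j _ /=.
by rewrite killingDr killingZr scalerA -scalerDl; congr (_ *: _); ring.
Qed.

HB.instance Definition _ t := GRing.isLinear.Build F g g *:%R (contract t) (contract_linear t).

Lemma contractP c s t y : contract (c *: s + t) y = c *: contract s y + contract t y.
Proof.
rewrite /contract scaler_sumr -big_split; apply: eq_bigr => i _ /=.
rewrite scaler_sumr -big_split; apply: eq_bigr => j _ /=.
by rewrite !mxE scalerA -scalerDl; congr (_ *: _); ring.
Qed.

Lemma contractDl s t y : contract (s + t) y = contract s y + contract t y.
Proof. by rewrite -[s]scale1r contractP !scale1r. Qed.

Lemma contract0l y : contract 0 y = 0.
Proof. by rewrite /contract big1// => i _; rewrite big1// => j _;
  rewrite mxE mul0r scale0r. Qed.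

Lemma contractZl c s y : contract (c *: s) y = c *: contract s y.
Proof. by rewrite -[c *: s]addr0 contractP contract0l addr0. Qed.

Lemma contractNl s y : contract (- s) y = - contract s y.
Proof. by rewrite -scaleN1r contractZl scaleN1r. Qed.

Lemma contract_suml (I : Type) (r : seq I) (P : pred I) (f : I -> tensor2 g) y :
  contract (\sum_(i <- r | P i) f i) y = \sum_(i <- r | P i) contract (f i) y.
Proof.
by apply: (big_morph (contract^~ y)) => [s t|]; [exact: contractDl|exact: contract0l].
Qed.

Lemma contract_tens2 x z y : contract (tens2 x z) y = killing z y *: x.
Proof.
rewrite /contract {2}(coord_basis e_basis (memvf x)) scaler_sumr; apply: eq_bigr => i _.
rewrite -scaler_suml scalerA; congr (_ *: _).
rewrite {2}(coord_basis e_basis (memvf z)) killing_suml mulr_suml.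
by apply: eq_bigr => j _; rewrite !mxE killingZl; ring.
Qed.

(** Exchanging the two legs is taking the adjoint for K; this is how X^21 enters. *)
Lemma killing_contract t y z : killing (contract t y) z = killing y (contract t^T z).
Proof.
rewrite /contract killing_suml killing_sumr.
under eq_bigr do rewrite killing_suml; under [RHS]eq_bigr do rewrite killing_sumr.
rewrite exchange_big; apply: eq_bigr => i _; apply: eq_bigr => j _ /=.
by rewrite killingZl killingZr mxE [killing y _]killingC; ring.
Qed.

Hypothesis K_nondeg : killing_nondeg g.

Definition gram : 'M[F]_n := \matrix_(k, l) killing e`_k e`_l.

(** A vector of the left kernel is an element orthogonal to g. Hence [invmx] in [dual_basis] is a
    genuine inverse. *)
Lemma gram_unit : gram \in unitmx.
Proof.
rewrite -row_free_unit -kermx_eq0; apply/rowV0P => v /sub_kermxP vG.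
suff w0 : vecof e v = 0 by rewrite -(vecofK e_basis v) w0 linear0.
apply: K_nondeg => y; rewrite (coord_basis e_basis (memvf y)) killing_sumr big1// => j _.
rewrite killingZr /vecof killing_suml.
have /rowP/(_ j) := vG; rewrite !mxE => vGj.
rewrite (eq_bigr (fun i => v 0 i * gram i j)) ?vGj ?mulr0// => i _.
by rewrite killingZl mxE.
Qed.

Lemma killing_dual_basis (i j : 'I_n) : killing e`_j (dual_basis i) = (j == i)%:R.
Proof.
rewrite killingC /dual_basis killing_suml eq_sym.
have /matrixP/(_ i j) := mulVmx gram_unit; rewrite !mxE => <-.
by apply: eq_bigr => k _; rewrite killingZl !mxE.
Qed.

Lemma sum_dual_basis y : \sum_(i < n) killing (dual_basis i) y *: e`_i = y.
Proof.
rewrite [RHS](coord_basis e_basis (memvf y)); apply: eq_bigr => i _; congr (_ *: _).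
rewrite {1}(coord_basis e_basis (memvf y)) killing_sumr (bigD1 i)//= big1 => [|j ji].
  by rewrite killingZr killingC killing_dual_basis eqxx mulr1 addr0.
by rewrite killingZr killingC killing_dual_basis (negPf ji) mulr0.
Qed.

(** Omega is the kernel of the identity, so v Omega / (u - v) contracts with y to v y / (u - v). *)
Lemma contract_casimir y : contract (casimir g) y = y.
Proof.
by rewrite contract_suml -[RHS]sum_dual_basis; apply: eq_bigr => i _; rewrite contract_tens2.
Qed.

Lemma contract_inj s t : (forall y, contract s y = contract t y) -> s = t.
Proof.
move=> st; suff G : s *m gram = t *m gram by rewrite -[s](mulmxK gram_unit) G mulmxK ?gram_unit.
apply/matrixP => i k; have /(congr1 (coord e i)) := st e`_k.
have cE (r : tensor2 g) : coord e i (contract r e`_k) = (r *m gram) i k.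
  rewrite /contract linear_sum (bigD1 i)//= [X in _ + X]big1 ?addr0 => [|l /negPf li].
    rewrite linear_sum/= mxE; apply: eq_bigr => j _.
    by rewrite linearZ/= coord_free ?(basis_free e_basis)// eqxx mulr1 mxE.
  rewrite linear_sum/= big1// => j _.
  by rewrite linearZ/= coord_free ?(basis_free e_basis)// [_ == _]li mulr0.
by rewrite !cE.
Qed.

End Contraction.

(** * The subspace W0 as a graph of r0 *)

Section W0.
Variables (F : numFieldType) (g : lieAlgType F) (H : {vspace g}).
Variables (pos : seq (cartan_dual H)) (ev : cartan_dual H -> g).
Hypotheses (g_simple : simple_lie g) (H_cartan : cartan_subalgebra H).
Hypotheses (pos_positive : positive_system pos) (e_root : root_vectors ev).
Implicit Types (x y h : g) (a b : cartan_dual H).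

Local Notation rho := (contract (r0 pos ev)).
Let Kn := killing_nondeg_roots H_cartan g_simple e_root.

Lemma rhoE y : rho y = 2%:R^-1 *:
  (\sum_(a <- pos) (killing (ev (- a)) y *: ev a - killing (ev a) y *: ev (- a)) + y).
Proof.
rewrite /r0 contractZl contractDl contract_casimir// contract_suml; congr (_ *: (_ + _)).
by apply: eq_bigr => a _; rewrite /wedge contractDl contractNl !contract_tens2.
Qed.

Lemma pos_root a : a \in pos -> is_root a.
Proof. by case: pos_positive => _ + _ _; apply. Qed.

Lemma pos_add_neq0 a b : a \in pos -> b \in pos -> a + b != 0.
Proof.
move=> ap bp; apply/eqP => /eqP; rewrite addr_eq0 => /eqP aE.
by case: pos_positive => _ _ /(_ b (pos_root bp)); rewrite bp -aE ap.
Qed.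

Lemma ev_pos a : a \in pos -> ev a \in root_space a.
Proof. by move/pos_root/e_root => -[]. Qed.

Lemma ev_neg a : a \in pos -> ev (- a) \in root_space (- a).
Proof. by move/pos_root/(is_rootN H_cartan g_simple e_root)/e_root => -[]. Qed.

Lemma half_double (V : lmodType F) (x : V) : 2%:R^-1 *: (x + x) = x.
Proof. by rewrite -mulr2n -scaler_nat scalerA mulVf ?scale1r ?pnatr_eq0. Qed.

(** Omega / 2 acts as 1/2 everywhere, and the skew part of r0 as 0 on H, 1/2 on positive and -1/2 on
    negative root spaces. Hence the values 1/2, 1 and 0 in this lemma and the next two. *)
Lemma rho_cartan h : h \in H -> rho h = 2%:R^-1 *: h.
Proof.
move=> hH; rewrite rhoE big_seq big1 ?add0r// => a ap.
have a0 := root_neq0 (pos_root ap).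
rewrite ![killing _ h]killingC (killing_cartan_root H_cartan a0 hH (ev_pos ap)).
have aN0 : - a != 0 by rewrite oppr_eq0.
by rewrite (killing_cartan_root H_cartan aN0 hH (ev_neg ap)) !scale0r subr0.
Qed.

Lemma rho_pos b x : b \in pos -> x \in root_space b -> rho x = x.
Proof.
move=> bp xb; case: pos_positive => pos_uniq _ _ _.
rewrite rhoE (bigD1_seq b)//= big_seq_cond big1 => [|a /andP[ap ab]].
  rewrite (killing_root_space (pos_add_neq0 bp bp) (ev_pos bp) xb) scale0r subr0 addr0.
  have := root_line H_cartan g_simple e_root (is_rootN H_cartan g_simple e_root (pos_root bp)).
  by rewrite opprK => /(_ x xb) <-; rewrite half_double.
rewrite (killing_root_space (pos_add_neq0 ap bp) (ev_pos ap) xb) scale0r subr0.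
by rewrite (killing_root_space _ (ev_neg ap) xb) ?scale0r// addrC subr_eq0 eq_sym.
Qed.

Lemma rho_neg b x : b \in pos -> x \in root_space (- b) -> rho x = 0.
Proof.
move=> bp xb; case: pos_positive => pos_uniq _ _ _.
rewrite rhoE (bigD1_seq b)//= big_seq_cond big1 => [|a /andP[ap ab]].
  have bb : - b + - b != 0 by rewrite -opprD oppr_eq0 pos_add_neq0.
  rewrite (killing_root_space bb (ev_neg bp) xb) scale0r sub0r addr0.
  by rewrite -(root_line H_cartan g_simple e_root (pos_root bp) xb) addNr scaler0.
have ab2 : - a + - b != 0 by rewrite -opprD oppr_eq0 pos_add_neq0.
rewrite (killing_root_space ab2 (ev_neg ap) xb) scale0r sub0r.
by rewrite (killing_root_space _ (ev_pos ap) xb) ?scale0r ?oppr0// subr_eq0.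
Qed.

Local Notation npos := (\sum_(a <- pos) root_space a)%VS.
Local Notation nneg := (\sum_(a <- pos) root_space (- a))%VS.

Lemma rho_npos x : x \in npos -> rho x = x.
Proof.
apply: (memv_sum_ind (P := fun x => rho x = x)) => [|y z|a y]; first exact: linear0.
  by rewrite linearD/= => -> ->.
exact: rho_pos.
Qed.

Lemma rho_nneg x : x \in nneg -> rho x = 0.
Proof.
apply: (memv_sum_ind (P := fun x => rho x = 0)) => [|y z|a y]; first exact: linear0.
  by rewrite linearD/= => -> ->; rewrite addr0.
exact: rho_neg.
Qed.

Lemma triangular_decomposition x :
  exists h y z, [/\ h \in H, y \in npos, z \in nneg & x = h + y + z].
Proof.
move: x; apply: (root_space_ind H_cartan) => [|_ _ [h [y [z [? ? ? ->]]]] [h' [y' [z' [? ?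
  ? ->]]]]|h hH|a x ra xa].
- by exists 0, 0, 0; rewrite !mem0v !addr0.
- exists (h + h'), (y + y'), (z + z'); rewrite !memvD//; split=> //.
  by rewrite addrACA [h + h' + _]addrACA addrACA.
- by exists h, 0, 0; rewrite !mem0v !addr0.
- case: pos_positive => _ _ /(_ a ra) + _; have [ap _|_ aNp] := boolP (a \in pos).
    by exists 0, x, 0; rewrite !mem0v add0r addr0; split=> //; apply: memv_sum_seq xa.
  exists 0, 0, x; rewrite !mem0v !add0r; split=> //.
  by apply: memv_sum_seq aNp _; rewrite opprK.
Qed.

Local Notation roots := (\sum_(a <- pos) (root_space a + root_space (- a)))%VS.

Lemma killing_cartan_roots h x : h \in H -> x \in roots -> killing h x = 0.
Proof.
move=> hH; apply: (memv_sum_ind (P := fun x => killing h x = 0)) => [|y z|a y ap].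
- exact: killing0r.
- by rewrite killingDr => -> ->; rewrite addr0.
- have a0 := root_neq0 (pos_root ap); have aN0 : - a != 0 by rewrite oppr_eq0.
  move=> /memv_addP[u ua [v va ->]].
  by rewrite killingDr !(killing_cartan_root H_cartan _ hH ua, killing_cartan_root H_cartan
    _ hH va)// addr0.
Qed.

Lemma npos_roots x : x \in npos -> x \in roots.
Proof.
apply: (memv_sum_ind (P := fun x => x \in roots)) => [|y z yr zr|a y ap ya];
  rewrite ?mem0v ?memvD//.
by apply: memv_sum_seq ap _; rewrite -[y]addr0 memv_add ?mem0v.
Qed.

Lemma nneg_roots x : x \in nneg -> x \in roots.
Proof.
apply: (memv_sum_ind (P := fun x => x \in roots)) => [|y z yr zr|a y ap ya];
  rewrite ?mem0v ?memvD//.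
by apply: memv_sum_seq ap _; rewrite -[y]add0r memv_add ?mem0v.
Qed.

(** H is orthogonal to the root spaces, so an element of the intersection is orthogonal to H and to
    all roots, that is to g. Directness makes [cartan_part] the expected projection. *)
Lemma cartan_roots0 : (H :&: roots = 0)%VS.
Proof.
apply/eqP; rewrite -subv0; apply/subvP => h /memv_capP[hH hr]; rewrite memv0; apply/eqP.
apply: Kn => x; have [k [y [z [kH yp zn ->]]]] := triangular_decomposition x.
rewrite !killingDr [killing h k]killingC !killing_cartan_roots// ?addr0//.
  exact: nneg_roots.
exact: npos_roots.
Qed.

Lemma cartan_partE h x : h \in H -> x \in roots -> cartan_part pos (h + x) = h.
Proof.
move=> hH xr; rewrite /cartan_part linearD/= daddv_pi_id ?cartan_roots0//.
have rH0 : (roots :&: H = 0)%VS by rewrite capvC cartan_roots0.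
have := daddv_pi_add cartan_roots0 (_ : x \in (H + roots)%VS).
rewrite -{1}[x]add0r memv_add ?mem0v// => /(_ isT) /eqP.
by rewrite (daddv_pi_id rH0 xr) -subr_eq0 addrK => /eqP ->; rewrite addr0.
Qed.

(** For a = h + y in b_+ and b = -h - z in b_-, a - b = 2h + y + z, which r0 maps to h + y = a: the
    factor 1/2 on H matches the condition on the Cartan parts. *)
Lemma W0P (w : loop_double g) :
  W0 pos w <-> (forall k : int, 0 < k -> w.1 k = 0) /\ w.1 0 = rho (w.1 0 - w.2).
Proof.
split=> [[w0 /memv_addP[h hH [y yp ->]] /memv_addP[k kH [z zn ->]]]|[w0 wE]].
  have [yr zr] := (npos_roots yp, nneg_roots zn).
  rewrite !cartan_partE// => /eqP; rewrite addr_eq0 => /eqP hk.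
  split=> //; rewrite opprD addrACA -hk linearD linearB/=.
  by rewrite (rho_npos yp) (rho_nneg zn) subr0 rho_cartan ?memvD// half_double.
have [h [y [z [hH yp zn xE]]]] := triangular_decomposition (w.1 0 - w.2).
have w1 : w.1 0 = 2%:R^-1 *: h + y.
  by rewrite wE xE !linearD/= rho_cartan// rho_npos// rho_nneg// addr0.
have w2 : w.2 = - (2%:R^-1 *: h) - z.
  have -> : w.2 = w.1 0 - (w.1 0 - w.2) by rewrite opprB addrC subrK.
  rewrite xE w1 -{2}(half_double h) scalerDr -[_ + y + z]addrA addrACA.
  by rewrite opprD addrA subrr add0r opprD.
split=> //.
- by rewrite w1 memv_add// memvZ.
- by rewrite w2 memv_add// memvN// memvZ.
- have [yr zr] := (npos_roots yp, nneg_roots zn).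
  by rewrite w1 w2 !cartan_partE ?memvN ?memvZ// subrr.
Qed.

End W0.

(** * The double of the loop algebra *)

Section IntSums.

(** The interval [-M, M], ordered so that sums split into [Posz] and [Negz] parts. *)
Definition zrange (M : nat) : seq int :=
  [seq Posz k | k <- iota 0 M.+1] ++ [seq Negz k | k <- iota 0 M].

Lemma mem_zrange M (i : int) : (i \in zrange M) = (`|i| <= M)%N.
Proof.
rewrite mem_cat; case: i => k.
  rewrite orb_idr => [|/mapP[]//]; rewrite (@mem_map _ _ Posz) ?mem_iota//.
  by move=> ? ? [].
rewrite orb_idl => [|/mapP[]//].
by rewrite (@mem_map _ _ Negz) ?mem_iota//; move=> ? ? [].
Qed.

Lemma zrange_uniq M : uniq (zrange M).
Proof.
rewrite cat_uniq !map_inj_uniq ?iota_uniq ?andbT//=; try by move=> ? ? [].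
by apply/hasPn => _ /mapP[k _ ->]; apply/mapP => -[].
Qed.

Lemma fsum_zrange (V : nmodType) (G : int -> V) M :
  (forall i : int, (M < `|i|)%N -> G i = 0) ->
  \sum_(i \in [set: int]) G i = \sum_(i <- zrange M) G i.
Proof.
move=> G0; rewrite (@bigfs _ _ _ _ (zrange M) predT) ?zrange_uniq//.
  by apply: eq_fsbigl; apply/seteqP; split.
by move=> i _; rewrite mem_zrange -ltnNge; exact: G0.
Qed.

Lemma sum_zrange (V : nmodType) (G : int -> V) M :
  \sum_(i <- zrange M) G i = \sum_(k < M.+1) G k%:Z + \sum_(k < M) G (Negz k).
Proof.
rewrite /zrange big_cat !big_map -(big_mkord xpredT (fun k => G (Posz k))).
by rewrite -(big_mkord xpredT (fun k => G (Negz k))) /index_iota !subn0.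
Qed.

Lemma fsum_exchange (V : nmodType) (G : int -> int -> V) M :
  (forall i j : int, (M < `|i|)%N \/ (M < `|j|)%N -> G i j = 0) ->
  \sum_(i \in [set: int]) \sum_(j \in [set: int]) G i j =
  \sum_(j \in [set: int]) \sum_(i \in [set: int]) G i j.
Proof.
move=> G0; rewrite (fsum_zrange (M := M)) => [|i Mi]; last first.
  by apply: fsbig1 => j _; apply: G0; left.
rewrite [RHS](fsum_zrange (M := M)) => [|j Mj]; last first.
  by apply: fsbig1 => i _; apply: G0; right.
rewrite (eq_bigr (fun i => \sum_(j <- zrange M) G i j)) => [|i _]; last first.
  by apply: fsum_zrange => j Mj; apply: G0; right.
rewrite exchange_big; apply: eq_bigr => j _; apply/esym.
by apply: fsum_zrange => i Mi; apply: G0; left.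
Qed.

End IntSums.

(* The coefficients through which w pairs with V0:
   Q w (x u^l, x 0^l) = K (pole_coef w l) x. *)
HB.lock Definition pole_coef (F : fieldType) (g : lieAlgType F) (w : loop_double g)
    (l : nat) : g :=
  w.1 (- l%:Z) - (if l == 0%N then w.2 else 0).

Section LoopDouble.
Variables (F : fieldType) (g : lieAlgType F).
Local Notation D := (loop_double g).
Implicit Types (f h : laurent g) (w z : D) (x y : g).

Lemma laurent_bound f : exists N : nat, forall k : int, N%:Z < k -> f k = 0.
Proof.
have /asboolP[N Nf] := lcoefP f; exists `|N|%N => k Nk; apply: Nf.
by apply: le_lt_trans Nk; rewrite abszE ler_norm.
Qed.

Lemma laurent_eqP f h : (forall k, f k = h k) -> f = h.
Proof. by move=> fh; apply: val_inj; apply/funext. Qed.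

Lemma double_eqP w z : (forall k, w.1 k = z.1 k) -> w.2 = z.2 -> w = z.
Proof. by case: w z => [f a] [h b] /= /laurent_eqP-> ->. Qed.

Lemma double_coefP c w z (k : int) : (c *: w + z).1 k = c *: w.1 k + z.1 k.
Proof. by []. Qed.

Lemma pole_coefS w l : pole_coef w l.+1 = w.1 (Negz l).
Proof. by rewrite pole_coef.unlock subr0 -NegzE. Qed.

Lemma pole_coef0 w : pole_coef w 0 = w.1 0 - w.2.
Proof. by rewrite pole_coef.unlock oppr0. Qed.

Lemma pole_coefP c w z l : pole_coef (c *: w + z) l = c *: pole_coef w l + pole_coef z l.
Proof.
rewrite !pole_coef.unlock double_coefP scalerBr; case: eqP => _;
  first by rewrite /= opprD addrACA.
by rewrite scaler0 !subr0.
Qed.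

Definition deg_le w (N : nat) := forall k : int, N%:Z < k -> w.1 k = 0.

Lemma deg_leW w (N M : nat) : (N <= M)%N -> deg_le w N -> deg_le w M.
Proof. by move=> NM wN k Mk; apply: wN; apply: le_lt_trans Mk; rewrite lez_nat. Qed.

Lemma deg_le_ex w : exists N, deg_le w N.
Proof. exact: laurent_bound. Qed.

Lemma deg_le_ex2 w z : exists N, deg_le w N /\ deg_le z N.
Proof.
have [[N wN] [M zM]] := (deg_le_ex w, deg_le_ex z); exists (maxn N M).
by split; [apply: deg_leW wN; rewrite leq_maxl|apply: deg_leW zM; rewrite leq_maxr].
Qed.

Lemma deg_le_ex3 w z t : exists N, [/\ deg_le w N, deg_le z N & deg_le t N].
Proof.
have [[N [wN zN]] [M tM]] := (deg_le_ex2 w z, deg_le_ex t); exists (maxn N M).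
by split; [apply: deg_leW wN|apply: deg_leW zN|apply: deg_leW tM]; rewrite ?leq_maxl ?leq_maxr.
Qed.

(** The second component is recovered from the pole coefficient of index 0 and [w.1 0]. *)
Lemma double_pole_eqP w z : (forall k : nat, w.1 k = z.1 k) ->
  (forall k, pole_coef w k = pole_coef z k) -> w = z.
Proof.
move=> wz pwz; apply: double_eqP => [[k|k]|].
- exact: wz.
- by rewrite -!pole_coefS.
- by have := pwz 0%N; rewrite !pole_coef0 wz => /addrI/oppr_inj.
Qed.

Lemma cauchy_coef0_zrange (w z : D) N : deg_le w N -> deg_le z N ->
  cauchy_coef (@killing F g) w.1 z.1 0 =
  \sum_(i <- zrange N) killing (w.1 i) (z.1 (- i)).
Proof.
move=> wN zN; rewrite /cauchy_coef; under eq_fsbigr do rewrite sub0r.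
apply: fsum_zrange => -[k|k] Nk; first by rewrite wN ?killing0l// ltz_nat.
by rewrite [X in killing _ X]zN ?killing0r// NegzE opprK ltz_nat.
Qed.

(** The terms of index k and -k of the Cauchy sum give the two families. The correction is that of
    index 0, where a = f_0 - y_0 and b = g_0 - z_0 are substituted in K(f_0, g_0) - K(a, b). *)
Lemma Q_pole w z N : deg_le w N -> deg_le z N ->
  Q w z = \sum_(k < N.+1) (killing (w.1 k) (pole_coef z k) + killing (pole_coef w k) (z.1 k))
          - killing (pole_coef w 0) (pole_coef z 0).
Proof.
move=> wN zN; rewrite /Q (cauchy_coef0_zrange wN zN) sum_zrange !big_ord_recl/=.
rewrite oppr0 !pole_coef0.
have -> : \sum_(i < N) (killing (w.1 (bump 0 i)) (pole_coef z (bump 0 i)) +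
      killing (pole_coef w (bump 0 i)) (z.1 (bump 0 i))) =
    \sum_(i < N) killing (w.1 (bump 0 i)) (z.1 (- (bump 0 i)%:Z)) +
    \sum_(k < N) killing (w.1 (Negz k)) (z.1 (- Negz k)).
  by rewrite -big_split; apply: eq_bigr => k _; rewrite !pole_coefS.
rewrite !(killingDl, killingDr, killingNl, killingNr).
ring.
Qed.

Lemma QC w z : Q w z = Q z w.
Proof.
have [N [wN zN]] := deg_le_ex2 w z; rewrite (Q_pole wN zN) (Q_pole zN wN).
congr (_ - _); last exact: killingC.
by apply: eq_bigr => k _; rewrite addrC killingC [X in _ + X]killingC.
Qed.

Lemma deg_leP c w z N : deg_le w N -> deg_le z N -> deg_le (c *: w + z) N.
Proof.
by move=> wN zN k Nk; rewrite double_coefP wN// zN// scaler0 addr0.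
Qed.

Lemma Q_linear w : linear (Q w : D -> F^o).
Proof.
move=> c z t; have [N [wN zN tN]] := deg_le_ex3 w z t.
change (Q w (c *: z + t) = c * Q w z + Q w t);
  rewrite (Q_pole wN zN) (Q_pole wN tN) (Q_pole wN (deg_leP c zN tN)).
rewrite pole_coefP mulrBr mulr_sumr addrACA -big_split -opprD.
rewrite killingDr killingZr; congr (_ - _); apply: eq_bigr => k _.
by rewrite pole_coefP double_coefP !killingDr !killingZr /=; ring.
Qed.

HB.instance Definition _ w := GRing.isLinear.Build F D F^o *:%R (Q w : D -> F^o) (Q_linear w).

Lemma QDr w z t : Q w (z + t) = Q w z + Q w t. Proof. exact: linearD. Qed.
Lemma QNr w z : Q w (- z) = - Q w z. Proof. exact: linearN. Qed.
Lemma QZr c w z : Q w (c *: z) = c * Q w z. Proof. exact: linearZ. Qed.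
Lemma QDl w z t : Q (w + z) t = Q w t + Q z t.
Proof. by rewrite QC QDr ![Q t _]QC. Qed.
Lemma QNl w z : Q (- w) z = - Q w z. Proof. by rewrite QC QNr QC. Qed.
Lemma QZl c w z : Q (c *: w) z = c * Q w z. Proof. by rewrite QC QZr QC. Qed.

Lemma llie_zrange f h N (k : int) M : (forall i : int, N%:Z < i -> f i = 0) ->
  (forall i : int, N%:Z < i -> h i = 0) -> (N + `|k| <= M)%N ->
  llie f h k = \sum_(i <- zrange M) lie (f i) (h (k - i)).
Proof.
move=> fN hN kM; apply: fsum_zrange => i Mi.
have [iN|iN] := ltP N%:Z i; first by rewrite fN// lie0x.
by rewrite hN ?liex0//; lia.
Qed.

Lemma double_lieC w z : double_lie w z = - double_lie z w.
Proof.
have [N [wN zN]] := deg_le_ex2 w z.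
apply: double_eqP => [k|]; last by rewrite /= lieC.
change (llie w.1 z.1 k = - llie z.1 w.1 k); rewrite /llie/= /cauchy_coef.
rewrite (reindex_fsbig (fun i => k - i) setT); last first.
  by split=> // [i j _ _ /addrI/oppr_inj|i _]//; exists (k - i) => //=; rewrite subKr.
have -> : \sum_(i \in [set: int]) lie (w.1 (k - i)) (z.1 (k - (k - i))) =
    \sum_(i \in [set: int]) - lie (z.1 i) (w.1 (k - i)).
  by apply: eq_fsbigr => i _; rewrite subKr lieC.
have supp i : (N + `|k| < `|i|)%N -> lie (z.1 i) (w.1 (k - i)) = 0.
  move=> ki; have [iN|iN] := ltP N%:Z i; first by rewrite zN// lie0x.
  by rewrite wN ?liex0//; lia.
rewrite !(fsum_zrange (M := N + `|k|)) ?sumrN// => i /supp ->//.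
by rewrite oppr0.
Qed.

Lemma double_lie_linear w : linear (double_lie w : D -> D).
Proof.
move=> c z t; have [N [wN zN tN]] := deg_le_ex3 w z t.
apply: double_eqP => [k|]; last by rewrite /= linearP.
change (llie w.1 (c *: z + t).1 k = c *: llie w.1 z.1 k + llie w.1 t.1 k).
rewrite (llie_zrange wN zN (leqnn _)) (llie_zrange wN tN (leqnn _)).
rewrite (llie_zrange wN (deg_leP c zN tN) (leqnn _)) scaler_sumr -big_split/=.
by apply: eq_bigr => i _; rewrite -linearP.
Qed.

HB.instance Definition _ w :=
  GRing.isLinear.Build F D D *:%R (@double_lie F g w) (double_lie_linear w).

Lemma double_lieDr w z t : double_lie w (z + t) = double_lie w z + double_lie w t.
Proof. exact: linearD. Qed.

Lemma double_lieDl w z t : double_lie (w + z) t = double_lie w t + double_lie z t.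
Proof. by rewrite double_lieC linearD/= opprD -!double_lieC. Qed.

Lemma killing_fsuml (G : int -> g) y M : (forall i : int, (M < `|i|)%N -> G i = 0) ->
  killing (\sum_(i \in [set: int]) G i) y = \sum_(i \in [set: int]) killing (G i) y.
Proof.
move=> G0; rewrite (fsum_zrange G0) killing_suml (fsum_zrange (M := M))// => i Mi.
by rewrite G0 ?killing0l.
Qed.

Lemma Q_lie (a b c : D) : Q (double_lie a b) c = Q a (double_lie b c).
Proof.
have [N [aN bN cN]] := deg_le_ex3 a b c.
rewrite /Q /= killing_lie; congr (_ - _); rewrite /cauchy_coef.
pose G i j := killing (lie (a.1 j) (b.1 (i - j))) (c.1 (0 - i)).
have suppL i : forall j : int, (N + `|i| < `|j|)%N -> lie (a.1 j) (b.1 (i - j)) = 0.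
  move=> j ij; have [jN|jN] := ltP N%:Z j; first by rewrite aN// lie0x.
  by rewrite bN ?liex0//; lia.
have suppR j : forall i : int, (N + `|j| < `|i|)%N -> lie (b.1 i) (c.1 (0 - j - i)) = 0.
  move=> i ij; have [iN|iN] := ltP N%:Z i; first by rewrite bN// lie0x.
  by rewrite cN ?liex0//; lia.
have -> : \sum_(i \in [set: int]) killing (\sum_(j \in [set: int]) lie (a.1 j) (b.1 (i -
  j))) (c.1 (0 - i))
    = \sum_(i \in [set: int]) \sum_(j \in [set: int]) G i j.
  by apply: eq_fsbigr => i _; rewrite (killing_fsuml _ (suppL i)).
(* In a nonzero term j, i - j and -i are at most N, so |i| and |j| are at most 2N; 3N is a safe
   bound. *)
rewrite (fsum_exchange (M := (3 * N)%N)) => [|i j ij]; last first.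
  rewrite /G; have [jN|jN] := ltP N%:Z j; first by rewrite aN// lie0x killing0l.
  have [iN|iN] := ltP N%:Z (0 - i); first by rewrite cN// killing0r.
  by rewrite bN ?liex0 ?killing0l//; case: ij => ij; lia.
apply: eq_fsbigr => j _; rewrite killingC (killing_fsuml _ (suppR j)).
(* This shift turns the inner sum into a coefficient of [b, c]. *)
rewrite (reindex_fsbig (fun i => i + j) setT); last first.
  by split=> // [i k _ _ /addIr|i _]//; exists (i - j) => //; rewrite subrK.
apply: eq_fsbigr => i _; rewrite /G killing_lie killingC addrK.
by have -> : 0 - (i + j) = 0 - j - i by ring.
Qed.

Lemma V0P w : V0 w <-> forall k, pole_coef w k = 0.
Proof.
split=> [[f f0 <-] [|k]|w0].
- by rewrite pole_coef0 subrr.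
- by rewrite pole_coefS f0.
- exists w.1; first by move=> [k|k]// _; rewrite -pole_coefS w0.
  by apply: double_eqP => //=; have := w0 0%N; rewrite pole_coef0 => /eqP;
    rewrite subr_eq0 => /eqP.
Qed.

(** Only w need have degree at most N: the positive coefficients of z meet pole coefficients of w,
    which vanish. *)
Lemma Q_V0 w z N : deg_le w N -> V0 w ->
  Q w z = \sum_(k < N.+1) killing (w.1 k) (pole_coef z k).
Proof.
move=> wN /V0P w0; have [M zM] := deg_le_ex z.
rewrite (Q_pole (deg_leW (leq_maxl N M) wN) (deg_leW (leq_maxr N M) zM)).
rewrite w0 killing0l subr0; have NM := leq_maxl N M.
rewrite [RHS](big_ord_widen (maxn N M).+1 (fun k : nat => killing (w.1 k) (pole_coef z k)))//.
rewrite [RHS]big_mkcond/=; apply: eq_bigr => k _; rewrite w0 killing0l addr0.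
by case: ltnP => // Nk; rewrite wN ?killing0l.
Qed.

Lemma V0_isotropic w z : V0 w -> V0 z -> Q w z = 0.
Proof.
move=> w0 /V0P z0; have [N wN] := deg_le_ex w; rewrite (Q_V0 _ wN w0).
by rewrite big1// => k _; rewrite z0 killing0r.
Qed.

Lemma V0_snd w : V0 w -> w.2 = w.1 0.
Proof. by case=> f _ <-. Qed.

Lemma V0_neg w k : V0 w -> w.1 (Negz k) = 0.
Proof. by case=> f f0 <-; exact: f0. Qed.

Lemma V0_0 : V0 (0 : D).
Proof. by exists 0 => //; exact: double_eqP. Qed.

(** The term of b in u^k carries the coefficient of index k + l to index l. This includes the second
    component, since b.2 = b.1 0. *)
Lemma pole_coef_lie b w N l : V0 b -> deg_le b N ->
  pole_coef (double_lie b w) l = \sum_(k < N.+1) lie (b.1 k) (pole_coef w (k + l)).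
Proof.
move=> b0 bN; rewrite !pole_coef.unlock.
have -> : (double_lie b w).1 (- l%:Z) = \sum_(k < N.+1) lie (b.1 k) (w.1 (- (k + l)%N%:Z)).
  have -> : (double_lie b w).1 (- l%:Z) =
      \sum_(i \in [set: int]) lie (b.1 i) (w.1 (- l%:Z - i)) by [].
  rewrite (fsum_zrange (M := N)) => [|[k|k] Nk]; last 2 first.
  - by rewrite bN ?lie0x// ltz_nat.
  - by rewrite V0_neg// lie0x.
  rewrite sum_zrange [X in _ + X]big1 ?addr0 => [|k _]; last by rewrite V0_neg ?lie0x.
  by apply: eq_bigr => k _; congr (lie _ (w.1 _)); rewrite PoszD; ring.
have <- : \sum_(k < N.+1) lie (b.1 k) (if (k + l == 0)%N then w.2 else 0) =
    if l == 0%N then (double_lie b w).2 else 0.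
  rewrite big_ord_recl big1 ?addr0 => [|k _]; last by rewrite /bump/= liex0.
  by rewrite add0n; case: eqP => _; rewrite ?liex0//= (V0_snd b0).
by rewrite -sumrB; apply: eq_bigr => k _; rewrite -linearB.
Qed.

Lemma V0_lie w z : V0 w -> V0 z -> V0 (double_lie w z).
Proof.
move=> w0 /V0P z0; have [N wN] := deg_le_ex w; apply/V0P => l.
by rewrite (pole_coef_lie _ _ w0 wN) big1// => k _; rewrite z0 liex0.
Qed.

Definition peval (N : nat) w (v : F) : g := \sum_(k < N.+1) v ^+ k *: w.1 k.

(* w represents the functional b |-> K (b(v)) y on V0 *)
Definition polar_at v y w := forall l, pole_coef w l = v ^+ l *: y.

Lemma Q_polar_at v y w b N : polar_at v y w -> V0 b -> deg_le b N ->
  Q b w = killing (peval N b v) y.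
Proof.
move=> wy b0 bN; rewrite (Q_V0 _ bN b0) /peval killing_suml; apply: eq_bigr => k _.
by rewrite wy killingZr killingZl.
Qed.

(** The functionals supported at the point v are stable under V0, which acts on them through
    evaluation at v. *)
Lemma polar_at_lie v y w b N : polar_at v y w -> V0 b -> deg_le b N ->
  polar_at v (lie (peval N b v) y) (double_lie b w).
Proof.
move=> wy b0 bN l; rewrite (pole_coef_lie _ _ b0 bN) /peval lie_suml scaler_sumr.
by apply: eq_bigr => k _; rewrite wy linearZ/= lieZl scalerA mulrC exprD.
Qed.

(** * Simple fractions in u *)

Section Polar.

Definition polar_coef (y : nat -> g) (m : int) : g :=
  if m is Negz k then y k.+1 else 0.

Lemma polar_subproof (y : nat -> g) : polar_coef y \in @bounded_above F g.
Proof. by apply/asboolP; exists 0 => -[]. Qed.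

(** With no nonnegative power of u available, [y 0] must sit in the second component, with the sign
    it has in [pole_coef]. *)
Definition polar (y : nat -> g) : D := (Laurent (polar_subproof y), - y 0%N).

Lemma pole_polar (y : nat -> g) k : pole_coef (polar y) k = y k.
Proof.
case: k => [|k]; last by rewrite pole_coefS.
by rewrite pole_coef0 /= sub0r opprK.
Qed.

(** For v nonzero, the function v y / (u - v): its expansion at u = oo and its value -y at u = 0. *)
Definition pole_vec v y : D := polar (fun l => v ^+ l *: y).

Lemma pole_vec_polar_at v y : polar_at v y (pole_vec v y).
Proof. by move=> l; rewrite pole_polar. Qed.

Lemma deg_le_polar (y : nat -> g) : deg_le (polar y) 0.
Proof. by move=> []. Qed.

Lemma Q_polar (y z : nat -> g) : Q (polar y) (polar z) = - killing (y 0%N) (z 0%N).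
Proof.
rewrite (Q_pole (deg_le_polar _) (deg_le_polar _)) big_ord1 !pole_polar.
by rewrite killing0l killing0r addr0 sub0r.
Qed.

(** Partial fraction decomposition of v1 v2 / ((u - v1)(u - v2)). *)
Lemma pole_vec_lie v1 v2 y1 y2 : v1 != v2 ->
  double_lie (pole_vec v1 y1) (pole_vec v2 y2) =
  (v1 - v2)^-1 *: (v2 *: pole_vec v1 (lie y1 y2) - v1 *: pole_vec v2 (lie y1 y2)).
Proof.
move=> v12; have d0 : v1 - v2 != 0 by rewrite subr_eq0.
apply: double_eqP => [[k|m]|].
- have -> : (double_lie (pole_vec v1 y1) (pole_vec v2 y2)).1 k%:Z =
    \sum_(i \in [set: int]) lie ((pole_vec v1 y1).1 i) ((pole_vec v2 y2).1 (k%:Z - i)) by [].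
  rewrite fsbig1 => [|[i|i] _]; last 2 first.
  + by rewrite lie0x.
  + by rewrite NegzE opprK -PoszD liex0.
  have -> : ((v1 - v2)^-1 *: (v2 *: pole_vec v1 (lie y1 y2) - v1 *: pole_vec v2 (lie y1
    y2))).1 k%:Z =
    (v1 - v2)^-1 *: (v2 *: (0 : g) - v1 *: 0) by [].
  by rewrite !scaler0 subr0 scaler0.
- have -> : (double_lie (pole_vec v1 y1) (pole_vec v2 y2)).1 (Negz m) =
    \sum_(i \in [set: int]) lie ((pole_vec v1 y1).1 i) ((pole_vec v2 y2).1 (Negz m - i)) by [].
  rewrite (fsum_zrange (M := m)) => [|[i|i] im]; last 2 first.
  + by rewrite lie0x.
  + have -> : Negz m - Negz i = (i - m)%N%:Z by move: im => /=; lia.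
    by rewrite liex0.
  rewrite sum_zrange big1 ?add0r => [|k _]; last by rewrite lie0x.
  have -> : ((v1 - v2)^-1 *: (v2 *: pole_vec v1 (lie y1 y2) - v1 *: pole_vec v2 (lie y1
    y2))).1 (Negz m) =
    (v1 - v2)^-1 *: (v2 *: (v1 ^+ m.+1 *: lie y1 y2) - v1 *: (v2 ^+ m.+1 *: lie y1 y2)) by [].
  rewrite !scalerA -scalerBl scalerA.
  have -> : v2 * v1 ^+ m.+1 - v1 * v2 ^+ m.+1 = v1 * v2 * (v1 ^+ m - v2 ^+ m).
    by rewrite !exprS; ring.
  (* Factoring v1 - v2 out of v1^m - v2^m leaves the m terms of the Cauchy product. *)
  rewrite -[v1 ^+ m - _]opprB subrXX -mulNr opprB mulrCA mulKf// mulr_sumr scaler_suml.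
  apply: eq_bigr => k _; have km := ltn_ord k.
  have -> : Negz m - Negz k = Negz (m - k.+1)%N by lia.
  have -> : (pole_vec v1 y1).1 (Negz k) = v1 ^+ k.+1 *: y1 by [].
  have -> : (pole_vec v2 y2).1 (Negz (m - k.+1)%N) = v2 ^+ (m - k.+1).+1 *: y2 by [].
  rewrite lieZl linearZ/= scalerA; congr (_ *: _).
  have -> : (m.-1 - k = m - k.+1)%N by lia.
  by rewrite !exprS; ring.
- have -> : ((v1 - v2)^-1 *: (v2 *: pole_vec v1 (lie y1 y2) - v1 *: pole_vec v2 (lie y1
  y2))).2 =
    (v1 - v2)^-1 *: (v2 *: - (1 *: lie y1 y2) - v1 *: - (1 *: lie y1 y2)) by [].
  rewrite /= !scale1r lieNl linearN opprK !scalerN opprK [- (v2 *: _) + _]addrC -scalerBl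
    scalerA.
  by rewrite mulVf// scale1r.
Qed.

End Polar.

End LoopDouble.

(** * Graphs of polynomial kernels *)

Lemma poly_injective_roots (R : idomainType) (q : {poly R}) (c : nat -> R) :
  injective c -> (forall k, root q (c k)) -> q = 0.
Proof.
move=> c_inj qc; apply/eqP; apply/negP => /negP q0.
have := @max_poly_roots _ q [seq c k | k <- iota 0 (size q)] q0.
rewrite size_map size_iota ltnn => H; apply: notF; apply: H.
  by apply/allP => _ /mapP[k _ ->].
by rewrite map_inj_uniq ?iota_uniq.
Qed.

Lemma natr_inj (F : numFieldType) : injective (fun k : nat => k%:R : F).
Proof. by move=> i j /eqP; rewrite eqr_nat => /eqP. Qed.

(** Multiplying q by the product over s makes every point a root. The set s holds the excluded
    coincidences of points. *)
Lemma poly_cofinite_roots (F : numFieldType) (q : {poly F}) (s : seq F) :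
  (forall v, v \notin s -> root q v) -> q = 0.
Proof.
move=> qs; have sn0 : \prod_(a <- s) ('X - a%:P) != 0 :> {poly F}.
  by rewrite monic_neq0 ?monic_prod_XsubC.
suff /eqP : q * \prod_(a <- s) ('X - a%:P) = 0.
  by rewrite mulf_eq0 (negPf sn0) orbF => /eqP.
apply: (poly_injective_roots (@natr_inj F)) => k; rewrite rootM root_prod_XsubC.
by have [|/qs ->] := boolP (k%:R \in s); rewrite ?orbT.
Qed.

Section Kernel.
Variables (F : numFieldType) (g : lieAlgType F).
Local Notation D := (loop_double g).
Implicit Types (w z : D) (x y : g).

(* P k l is the coefficient of u^k v^l in a polynomial with values in g (x) g *)
Variables (P : nat -> nat -> tensor2 g) (d : nat).
Hypothesis P_bound : forall k l, (d <= k)%N || (d <= l)%N -> P k l = 0.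

Definition kact (y : nat -> g) (k : nat) : g := \sum_(l < d) contract (P k l) (y l).

Lemma kact_ge (y : nat -> g) k : (d <= k)%N -> kact y k = 0.
Proof. by move=> dk; rewrite /kact big1// => l _; rewrite P_bound ?dk// contract0l. Qed.

Lemma eq_kact (y z : nat -> g) k : (forall l, y l = z l) -> kact y k = kact z k.
Proof. by move=> yz; apply: eq_bigr => l _; rewrite yz. Qed.

Definition kpoly_coef (y : nat -> g) (m : int) : g := if m is Posz k then kact y k else 0.

Lemma kpoly_subproof (y : nat -> g) : kpoly_coef y \in @bounded_above F g.
Proof.
apply/asboolP; exists d%:Z => -[k|k]//; rewrite ltz_nat => /ltnW dk.
exact: kact_ge.
Qed.

Definition kpoly (y : nat -> g) : D := diag_embed (Laurent (kpoly_subproof y)).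

Lemma V0_kpoly (y : nat -> g) : V0 (kpoly y).
Proof. by exists (Laurent (kpoly_subproof y)) => // -[]. Qed.

Lemma kpoly_nat (y : nat -> g) (k : nat) : (kpoly y).1 k = kact y k. Proof. by []. Qed.

Lemma deg_le_kpoly (y : nat -> g) : deg_le (kpoly y) d.
Proof. by move=> [k|k]//; rewrite ltz_nat => /ltnW dk; exact: kact_ge. Qed.

(* the graph element w0 + Phi(w0) whose pairing with x u^l is K (y l) x *)
Definition graph_vec (y : nat -> g) : D := polar y + kpoly y.

Lemma pole_coefD w z l : pole_coef (w + z) l = pole_coef w l + pole_coef z l.
Proof. by rewrite -[w]scale1r pole_coefP !scale1r. Qed.

Lemma pole_coefB w z l : pole_coef (w - z) l = pole_coef w l - pole_coef z l.
Proof. by rewrite addrC -scaleN1r pole_coefP scaleN1r addrC. Qed.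

Lemma pole_graph_vec (y : nat -> g) k : pole_coef (graph_vec y) k = y k.
Proof. by rewrite pole_coefD pole_polar (V0P _).1 ?addr0//; exact: V0_kpoly. Qed.

Lemma graph_vec_nat (y : nat -> g) (k : nat) : (graph_vec y).1 k = kact y k.
Proof. by rewrite -[RHS]add0r. Qed.

Lemma deg_le_graph_vec (y : nat -> g) : deg_le (graph_vec y) d.
Proof. by move=> [k|k]//; rewrite ltz_nat => /ltnW dk; rewrite graph_vec_nat;
  exact: kact_ge. Qed.

Definition Wker : set D := [set w : D | forall k : nat, w.1 k = kact (pole_coef w) k].

Lemma Wker_graph_vec (y : nat -> g) : Wker (graph_vec y).
Proof. by move=> k; rewrite graph_vec_nat; apply: eq_kact => l; rewrite pole_graph_vec. Qed.

Lemma WkerP w : Wker w -> w = graph_vec (pole_coef w).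
Proof. by move=> wW; apply: double_pole_eqP => k; rewrite ?graph_vec_nat ?pole_graph_vec. Qed.

Lemma Wker_submod : submod_closed [in Wker].
Proof.
split=> [|c w z].
  rewrite inE => k; rewrite /kact big1// => l _.
  have -> : pole_coef (0 : D) l = 0 by apply: (V0P _).1; exact: V0_0.
  exact: linear0.
rewrite !inE => wW zW k; rewrite double_coefP wW zW /kact scaler_sumr -big_split.
by apply: eq_bigr => l _; rewrite pole_coefP linearP.
Qed.

(** The pole coefficients of a tail element vanish below index N, and [kact] reads only those below
    d. *)
Lemma tail_Wker N : (d < N)%N -> tail N `<=` Wker.
Proof.
move=> dN w [w0 w2] k; rewrite w0; last by lia.
rewrite /kact big1// => l _; rewrite pole_coef.unlock w0 ?w2.
  by rewrite if_same subr0 linear0.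
by have := ltn_ord l; lia.
Qed.

(** The projection to [Wker] along V0 sends w to [graph_vec (pole_coef w)]. *)
Lemma complementary_Wker : complementary Wker V0.
Proof.
split; apply/seteqP; split=> //.
- move=> w [wW /V0P w0]; rewrite (WkerP wW).
  apply: double_pole_eqP => k; rewrite ?graph_vec_nat ?pole_graph_vec.
    by rewrite /kact big1// => l _; rewrite w0 linear0.
  by rewrite w0 (V0P _).1//; exact: V0_0.
- move=> _ ->; split; last exact: V0_0.
  by have [+ _] := Wker_submod; rewrite inE.
- move=> w _; exists (graph_vec (pole_coef w)); first exact: Wker_graph_vec.
  exists (w - graph_vec (pole_coef w)); last by rewrite addrC subrK.
  by apply/V0P => k; rewrite pole_coefB pole_graph_vec subrr.
Qed.

(** For fixed z only finitely many y_l matter; so for y_l = v^l x the pairing is a polynomial in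
    v. *)
Lemma Q_graph_vec_adjoint z : exists M (c : nat -> g),
  forall y : nat -> g, Q (graph_vec y) z = \sum_(l < M) killing (y l) (c l).
Proof.
have [N0 zN0] := deg_le_ex z; pose N := maxn d N0.
have zN : deg_le z N by apply: deg_leW zN0; rewrite leq_maxr.
have dN : (d <= N)%N by rewrite leq_maxl.
(* The three terms of [Q_pole], with the kernel moved to the side of z by transposition. *)
exists N.+1, (fun l => \sum_(k < N.+1) contract (P k l)^T (pole_coef z k) + z.1 l
  - (if l == 0%N then pole_coef z 0 else 0)) => y.
rewrite (Q_pole (deg_leW dN (deg_le_graph_vec y)) zN) big_split !pole_graph_vec.
under [RHS]eq_bigr do rewrite killingDr killingNr killingDr.
rewrite !big_split; congr (_ + _ + _).
- rewrite (eq_bigr (fun k : 'I_N.+1 =>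
    \sum_(l < N.+1) killing (y l) (contract (P k l)^T (pole_coef z k)))) => [|k _].
    by rewrite exchange_big; apply: eq_bigr => l _; rewrite killing_sumr.
  rewrite graph_vec_nat /kact (big_ord_widen N.+1 (fun l => contract (P k l) (y l))) ?leqW//.
  rewrite big_mkcond killing_suml; apply: eq_bigr => l _; rewrite -killing_contract.
  by case: ltnP => // dl; rewrite P_bound ?dl ?orbT// contract0l.
- by apply: eq_bigr => k _; rewrite pole_graph_vec.
- rewrite big_ord_recl big1 => [|k _]; first by rewrite /= addr0.
  by rewrite /bump /= killing0r oppr0.
Qed.

Definition eval_vec v y : D := graph_vec (fun l => v ^+ l *: y).

Lemma eval_vec_dense z (s : seq F) : (forall v x, v \notin s -> Q (eval_vec v x) z = 0) ->
  forall y : nat -> g, Q (graph_vec y) z = 0.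
Proof.
move=> z0 y; have [M [c cE]] := Q_graph_vec_adjoint z; rewrite cE big1// => l _.
(* Evaluation vectors are taken at [y l], so that the coefficient of v^l is the l-th term of the
   sum. *)
have : \poly_(k < M) killing (y l) (c k) = 0.
  apply: (@poly_cofinite_roots _ _ s) => v vs; have := z0 v (y l) vs; rewrite /eval_vec cE => H.
  rewrite /root horner_poly -[X in _ == X]H; apply/eqP; apply: eq_bigr => k _.
  by rewrite killingZl mulrC.
by move/(congr1 (fun q : {poly F} => q`_l)); rewrite coef_poly ltn_ord coef0.
Qed.

Definition isotropic (W : set D) := forall w z, W w -> W z -> Q w z = 0.

Lemma eval_vec_isotropic :
  (forall u v x y, u != v -> Q (eval_vec u x) (eval_vec v y) = 0) -> isotropic Wker.
Proof.
move=> ew0 w z wW zW; rewrite (WkerP wW); apply: (@eval_vec_dense _ [::]) => u x _.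
rewrite QC (WkerP zW); apply: (@eval_vec_dense _ [:: u]) => v y.
by rewrite inE => vu; exact: ew0.
Qed.

Hypothesis K_nondeg : killing_nondeg g.

(** If w is orthogonal to W, so is its V0-component v; as the y_l of elements of W are arbitrary,
    they detect every coefficient of v, and v = 0. *)
Lemma isotropic_lagrangian : isotropic Wker -> lagrangian Wker.
Proof.
move=> iso; apply/seteqP; split=> [w wW z zW|w wW]; first exact: iso.
pose v := w - graph_vec (pole_coef w).
have v0 : V0 v by apply/V0P => k; rewrite pole_coefB pole_graph_vec subrr.
have [N vN] := deg_le_ex v.
have vQ (y : nat -> g) : Q v (graph_vec y) = 0.
  by rewrite /v QDl QNl wW ?iso ?subrr//; exact: Wker_graph_vec.
suff vk (k : nat) : v.1 k = 0.
  have <- : graph_vec (pole_coef w) = w; last exact: Wker_graph_vec.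
  apply/esym/eqP; rewrite -subr_eq0 -/v; apply/eqP; apply: double_pole_eqP => k.
    by rewrite vk.
  by rewrite (V0P _).1// (V0P _).1//; exact: V0_0.
have [kN|Nk] := leqP k N; last by apply: vN; rewrite ltz_nat.
apply: K_nondeg => x; have := vQ (fun l => if l == k then x else 0).
rewrite (Q_V0 _ vN v0) (bigD1 (Ordinal (kN : (k < N.+1)%N)))//= big1 ?addr0.
  by rewrite pole_graph_vec eqxx.
by move=> l; rewrite -val_eqE /= => lk; rewrite pole_graph_vec ifN ?killing0r.
Qed.

Lemma lagrangian_mem (W : set D) w : lagrangian W -> (forall z, W z -> Q w z = 0) -> W w.
Proof. by move=> WE wW; rewrite WE. Qed.

Lemma Wker_ortho w : isotropic Wker -> (forall y : nat -> g, Q (graph_vec y) w = 0) -> Wker w.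
Proof.
move=> iso wP; apply: (lagrangian_mem (isotropic_lagrangian iso)) => z zW.
by rewrite QC (WkerP zW).
Qed.

(* Invariance of Q turns closure of W under the bracket into vanishing of
   Q([w1, w2], w3), which by density may be tested on generic evaluation
   vectors, one slot at a time. *)
Lemma eval_vec_lie_closed : isotropic Wker ->
  (forall u1 u2 u3 y1 y2 y3, u1 != u2 -> u1 != u3 -> u2 != u3 ->
     Q (double_lie (eval_vec u1 y1) (eval_vec u2 y2)) (eval_vec u3 y3) = 0) ->
  forall w z, Wker w -> Wker z -> Wker (double_lie w z).
Proof.
move=> iso T0.
have step1 u1 u2 y1 y2 : u1 != u2 -> Wker (double_lie (eval_vec u1 y1) (eval_vec u2 y2)).
  move=> u12; apply: Wker_ortho => //; apply: (@eval_vec_dense _ [:: u1; u2]) => v x.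
  rewrite !inE negb_or => /andP[vu1 vu2]; rewrite QC; apply: T0 => //; by rewrite eq_sym.
have step2 u1 y1 w : Wker w -> Wker (double_lie (eval_vec u1 y1) w).
  move=> wW; apply: Wker_ortho => //; apply: (@eval_vec_dense _ [:: u1]) => v x.
  rewrite inE => vu1; rewrite -Q_lie; apply: iso => //; exact: step1.
move=> w z wW zW; apply: Wker_ortho => //; apply: (@eval_vec_dense _ [::]) => v x _.
by rewrite -Q_lie; apply: iso => //; exact: step2.
Qed.

(** The index k runs up to d to match [peval d]; the terms with k = d are zero under [P_bound]. *)
Definition kval (u v : F) : tensor2 g :=
  \sum_(k < d.+1) \sum_(l < d) (u ^+ k * v ^+ l) *: P k l.

Definition kfun (u v : F) : tensor2 g := (v / (u - v)) *: casimir g + kval u v.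

Lemma peval_kpoly u v y : peval d (kpoly (fun l => v ^+ l *: y)) u = contract (kval u v) y.
Proof.
rewrite /kval contract_suml; apply: eq_bigr => k _; rewrite contract_suml kpoly_nat.
rewrite /kact scaler_sumr; apply: eq_bigr => l _.
by rewrite contractZl linearZ/= scalerA.
Qed.

Lemma contract_kfun u v y :
  contract (kfun u v) y = (v / (u - v)) *: y + contract (kval u v) y.
Proof. by rewrite contractDl contractZl contract_casimir. Qed.

Lemma eval_vecE v y : eval_vec v y = pole_vec v y + kpoly (fun l => v ^+ l *: y).
Proof. by []. Qed.

Lemma Q_pole_vec_kpoly u v x y :
  Q (pole_vec u x) (kpoly (fun l => v ^+ l *: y)) = killing x (contract (kval u v) y).
Proof.
rewrite QC (Q_polar_at (pole_vec_polar_at u x) (V0_kpoly _) (deg_le_kpoly _)).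
by rewrite peval_kpoly killingC.
Qed.

(** The singular parts on the right add up to v / (u - v) + u / (v - u) = -1, which is what the
    second components of the two pole vectors contribute to Q. *)
Lemma Q_eval_vec u v x y : u != v ->
  Q (eval_vec u x) (eval_vec v y) = killing x (contract (kfun u v) y) + killing (contract
    (kfun v u) x) y.
Proof.
move=> uv; rewrite !eval_vecE QDl !QDr Q_polar Q_pole_vec_kpoly [Q (kpoly _) (pole_vec _
  _)]QC Q_pole_vec_kpoly.
rewrite (V0_isotropic (V0_kpoly _) (V0_kpoly _)) !contract_kfun !expr0 !scale1r.
rewrite killingDr killingDl killingZr killingZl [killing y _]killingC.
have d1 : u - v != 0 by rewrite subr_eq0.
have -> : v - u = - (u - v) by rewrite opprB.
by field.
Qed.

Lemma killing_rot (x y z : g) : killing (lie x y) z = killing (lie y z) x.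
Proof. by rewrite killing_lie killingC. Qed.

Lemma killing_flip (x y z : g) : killing (lie x y) z = - killing (lie y x) z.
Proof. by rewrite lieC killingNl. Qed.

Lemma Q_flip (w z t : D) : Q (double_lie w z) t = - Q (double_lie z w) t.
Proof. by rewrite double_lieC QNl. Qed.

Lemma Q_rot (w z t : D) : Q (double_lie w z) t = Q (double_lie z t) w.
Proof. by rewrite Q_lie QC. Qed.

Lemma Q_pole_vec3 v1 v2 v3 y1 y2 y3 : v1 != v2 ->
  Q (double_lie (pole_vec v1 y1) (pole_vec v2 y2)) (pole_vec v3 y3) = killing (lie y1 y2) y3.
Proof.
move=> v12; have d0 : v1 - v2 != 0 by rewrite subr_eq0.
rewrite pole_vec_lie// QZl QDl QNl !QZl !Q_polar !expr0 !scale1r.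
by field.
Qed.

Lemma Q_pole_vec2_kpoly v1 v2 v3 y1 y2 y3 : v1 != v2 ->
  Q (double_lie (pole_vec v1 y1) (pole_vec v2 y2)) (kpoly (fun l => v3 ^+ l *: y3)) =
  (v1 - v2)^-1 * (v2 * killing (lie y1 y2) (contract (kval v1 v3) y3)
                - v1 * killing (lie y1 y2) (contract (kval v2 v3) y3)).
Proof. by move=> v12; rewrite pole_vec_lie// QZl QDl QNl !QZl !Q_pole_vec_kpoly. Qed.

Lemma Q_kpoly2_pole_vec v1 v2 v3 y1 y2 y3 :
  Q (double_lie (kpoly (fun l => v1 ^+ l *: y1)) (kpoly (fun l => v2 ^+ l *: y2)))
    (pole_vec v3 y3) =
  killing (lie (contract (kval v3 v1) y1) (contract (kval v3 v2) y2)) y3.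
Proof.
have pa := polar_at_lie (pole_vec_polar_at v3 y3) (V0_kpoly (fun l => v2 ^+ l *: y2))
  (deg_le_kpoly _).
rewrite Q_lie (Q_polar_at pa (V0_kpoly _) (deg_le_kpoly _)).
by rewrite !peval_kpoly killing_lie.
Qed.

(* the sum of residues at u = v1, v2, v3 of K([w1(u), w2(u)], w3(u)) du / u *)
Lemma Q_lie_eval_vec v1 v2 v3 y1 y2 y3 : v1 != v2 -> v1 != v3 -> v2 != v3 ->
  Q (double_lie (eval_vec v1 y1) (eval_vec v2 y2)) (eval_vec v3 y3) =
    killing (lie (contract (kfun v1 v2) y2) (contract (kfun v1 v3) y3)) y1
  - killing (lie (contract (kfun v2 v1) y1) (contract (kfun v2 v3) y3)) y2
  + killing (lie (contract (kfun v3 v1) y1) (contract (kfun v3 v2) y2)) y3.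
Proof.
move=> v12 v13 v23.
have d12 : v1 - v2 != 0 by rewrite subr_eq0.
have d13 : v1 - v3 != 0 by rewrite subr_eq0.
have d23 : v2 - v3 != 0 by rewrite subr_eq0.
rewrite !eval_vecE double_lieDl !double_lieDr !QDl !QDr.
set p1 := kpoly (fun l => v1 ^+ l *: y1); set p2 := kpoly (fun l => v2 ^+ l *: y2).
set p3 := kpoly (fun l => v3 ^+ l *: y3).
have -> : Q (double_lie p1 p2) p3 = 0.
  by apply: V0_isotropic; [apply: V0_lie|]; exact: V0_kpoly.
rewrite Q_pole_vec3// Q_pole_vec2_kpoly// Q_kpoly2_pole_vec.
(* Cyclic and skew symmetry of Q([., .], .) bring each remaining mixed term to a form already
   computed. *)
have -> : Q (double_lie (pole_vec v1 y1) p2) (pole_vec v3 y3) =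
          - Q (double_lie (pole_vec v1 y1) (pole_vec v3 y3)) p2 by rewrite Q_flip Q_rot.
rewrite Q_pole_vec2_kpoly//.
have -> : Q (double_lie (pole_vec v1 y1) p2) p3 = Q (double_lie p2 p3) (pole_vec v1 y1) by
  rewrite Q_rot.
rewrite Q_kpoly2_pole_vec.
have -> : Q (double_lie p1 (pole_vec v2 y2)) (pole_vec v3 y3) =
          Q (double_lie (pole_vec v2 y2) (pole_vec v3 y3)) p1 by rewrite Q_rot.
rewrite Q_pole_vec2_kpoly//.
have -> : Q (double_lie p1 (pole_vec v2 y2)) p3 = - Q (double_lie p1 p3) (pole_vec v2 y2).
  by rewrite Q_flip Q_rot.
rewrite Q_kpoly2_pole_vec !contract_kfun.
have -> : v2 - v1 = - (v1 - v2) by rewrite opprB.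
have -> : v3 - v1 = - (v1 - v3) by rewrite opprB.
have -> : v3 - v2 = - (v2 - v3) by rewrite opprB.
set b12 := contract (kval v1 v2) y2; set b13 := contract (kval v1 v3) y3.
set b21 := contract (kval v2 v1) y1; set b23 := contract (kval v2 v3) y3.
set b31 := contract (kval v3 v1) y1; set b32 := contract (kval v3 v2) y2.
rewrite !(lieDl, linearD)/= !(lieZl, linearZ)/= !killingDl !killingZl.
have -> : killing (lie y2 y3) y1 = killing (lie y1 y2) y3 by rewrite -killing_rot.
have -> : killing (lie y1 y3) y2 = - killing (lie y1 y2) y3.
  by rewrite killing_flip killing_rot.
have -> : killing (lie y2 b13) y1 = killing (lie y1 y2) b13 by rewrite -killing_rot.
have -> : killing (lie b12 y3) y1 = - killing (lie y1 y3) b12.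
  by rewrite killing_rot killing_flip.
have -> : killing (lie y1 b23) y2 = - killing (lie y1 y2) b23.
  by rewrite killing_flip killing_rot.
have -> : killing (lie b21 y3) y2 = - killing (lie y2 y3) b21.
  by rewrite killing_rot killing_flip.
have -> : killing (lie y1 b32) y3 = - killing (lie y1 y3) b32.
  by rewrite killing_flip killing_rot.
have -> : killing (lie b31 y2) y3 = killing (lie y2 y3) b31 by rewrite killing_rot.
(* With these ten values abstracted, an identity of rational functions in v1, v2, v3 remains. *)
move: (killing (lie y1 y2) y3) (killing (lie y1 y2) b13) (killing (lie y1 y2) b23)
  (killing (lie y1 y3) b12) (killing (lie y1 y3) b32) (killing (lie y2 y3) b21)
  (killing (lie y2 y3) b31) (killing (lie b12 b13) y1) (killing (lie b21 b23) y2)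
  (killing (lie b31 b32) y3) => k1 k2 k3 k4 k5 k6 k7 k8 k9 k10.
by field; rewrite d12 d13 d23.
Qed.

End Kernel.

(** * The Yang-Baxter equation *)

Section PolynomialKernels.
Variables (F : numFieldType) (g : lieAlgType F).
Local Notation n := (\dim {:g}).
Local Notation e := (vbasis {:g}).
Local Notation D := (loop_double g).
Implicit Types (p r : tpoly g) (w z : D) (x y : g).

Definition tcoef p (k l : nat) : tensor2 g := \matrix_(i, j) (p i j)`_l`_k.

Definition tbound p (d : nat) := forall i j,
  (size (p i j) <= d)%N /\ forall l, (size ((p i j)`_l)%R <= d)%N.

Lemma tboundW p d d' : (d <= d')%N -> tbound p d -> tbound p d'.
Proof.
move=> dd pd i j; have [pd1 pd2] := pd i j.
by split=> [|l]; [apply: leq_trans dd|apply: leq_trans (pd2 l) dd].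
Qed.

Lemma tbound_ex p : exists d, tbound p d.
Proof.
have bound1 (q : {poly {poly F}}) : exists d, (size q <= d)%N /\ forall l, (size (q`_l)%R
  <= d)%N.
  exists (size q + \sum_(l < size q) size (q`_l)%R)%N; split=> [|l]; first exact: leq_addr.
  have [lq|ql] := ltnP l (size q); last by rewrite nth_default// size_poly0.
  by rewrite (bigD1 (Ordinal lq))//= addnCA leq_addr.
have /choice[c cE] : forall ij : 'I_n * 'I_n, exists d,
    (size (p ij.1 ij.2) <= d)%N /\ forall l, (size ((p ij.1 ij.2)`_l)%R <= d)%N.
  by move=> ij; exact: bound1.
exists (\sum_ij c ij)%N => i j; have [c1 c2] := cE (i, j).
have le : (c (i, j) <= \sum_ij c ij)%N by rewrite (bigD1 (i, j))//= leq_addr.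
by split=> [|l]; [apply: leq_trans c1 le|apply: leq_trans (c2 l) le].
Qed.

Lemma tcoef_bound p d : tbound p d ->
  forall k l, (d <= k)%N || (d <= l)%N -> tcoef p k l = 0.
Proof.
move=> pd k l kl; apply/matrixP => i j; rewrite !mxE; have [p1 p2] := pd i j.
case/orP: kl => [dk|dl]; first by rewrite nth_default// (leq_trans (p2 l)).
by rewrite (nth_default _ (leq_trans p1 dl)) coef0.
Qed.

Lemma tpoly_evalE p d u v : tbound p d -> tpoly_eval p u v = kval (tcoef p) d u v.
Proof.
move=> pd; apply/matrixP => i j; rewrite !mxE summxE; have [p1 p2] := pd i j.
rewrite (horner_coef_wide _ p1) horner_sum.
under [RHS]eq_bigr do rewrite summxE.
rewrite exchange_big; apply: eq_bigr => l _.
rewrite -polyC_exp hornerM hornerC (horner_coef_wide _ (leqW (p2 l))) mulr_suml.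
by apply: eq_bigr => k _; rewrite !mxE; ring.
Qed.

Lemma quasi_trigE p d : tbound p d -> quasi_trig p = kfun (tcoef p) d.
Proof. by move=> pd; apply/funext => u; apply/funext => v;
  rewrite /quasi_trig (tpoly_evalE _ _ pd). Qed.

(** The singular terms cancel, and polynomials agreeing at all pairs of natural numbers are equal in
    characteristic zero. *)
Lemma quasi_trig_inj p p' : quasi_trig p = quasi_trig p' -> p = p'.
Proof.
move=> pp; have ev u v : tpoly_eval p u v = tpoly_eval p' u v.
  by have := congr1 (fun X => X u v) pp => /addrI.
apply/matrixP => i j; apply/eqP; rewrite -subr_eq0; apply/eqP.
have c_inj : injective (fun k : nat => (k%:R : F)%:P).
  by move=> a b /polyC_inj; exact: natr_inj.
apply: (poly_injective_roots c_inj) => k; rewrite /root; apply/eqP.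
apply: (poly_injective_roots (@natr_inj F)) => m; rewrite /root !hornerE subr_eq0.
by have /matrixP/(_ i j) := ev m%:R k%:R; rewrite !mxE => ->.
Qed.

Lemma poly_partK p : poly_part (quasi_trig p) = p.
Proof.
by apply: xget_unique => // q /quasi_trig_inj ->.
Qed.

Lemma Q_monom w x (l : nat) : Q w (diag_embed (monom x l)) = killing (pole_coef w l) x.
Proof.
have m0 : V0 (diag_embed (monom x l)) by exists (monom x l) => //= -[].
have ml : deg_le (diag_embed (monom x l)) l.
  by move=> k lk; rewrite /= gt_eqF.
rewrite QC (Q_V0 _ ml m0) (bigD1 ord_max)//= eqxx big1 ?addr0 => [|k kl]; first exact: killingC.
by rewrite -val_eqE/= in kl; rewrite eqz_nat (negPf kl) killing0l.
Qed.

Lemma double_nat_sum (I : Type) (s : seq I) (Pr : pred I) (u : I -> D) (k : int) :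
  (\sum_(i <- s | Pr i) u i).1 k = \sum_(i <- s | Pr i) (u i).1 k.
Proof. exact: (big_morph (fun w : D => w.1 k)). Qed.

Lemma V0_sum (I : Type) (s : seq I) (Pr : pred I) (u : I -> D) :
  (forall i, Pr i -> V0 (u i)) -> V0 (\sum_(i <- s | Pr i) u i).
Proof.
move=> u0; apply: (big_ind (fun w => V0 w)) => // [|w z /V0P w0 /V0P z0].
  by exact: V0_0.
by apply/V0P => k; rewrite pole_coefD w0 z0 addr0.
Qed.

Lemma V0_Z c w : V0 w -> V0 (c *: w).
Proof.
move=> /V0P w0; apply/V0P => k; rewrite -[c *: w]addr0 pole_coefP w0 scaler0 add0r.
by apply: (V0P _).1; exact: V0_0.
Qed.

Lemma V0_Phi r w : V0 (Phi r w).
Proof.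
do 4![apply: V0_sum => ? _]; apply: V0_Z.
by eexists; last by []; move=> [].
Qed.

(** By [Q_monom], Phi(r) sees w only through its pole coefficients. The sums, cut at the sizes of
    the entries of r, are padded with zeros up to d. *)
Lemma Phi_nat r d w (m : nat) : tbound r d ->
  (Phi r w).1 m = kact (tcoef r) d (pole_coef w) m.
Proof.
move=> rd; rewrite /Phi /kact double_nat_sum /contract exchange_big/=.
apply: eq_bigr => i _; rewrite double_nat_sum exchange_big/=.
apply: eq_bigr => j _; rewrite double_nat_sum; have [r1 r2] := rd i j.
rewrite (big_ord_widen d (fun l => (\sum_(k < size (r i j)`_l)
  ((r i j)`_l`_k * Q w (diag_embed (monom e`_j l))) *: diag_embed (monom e`_i k)).1 m)) //.
rewrite big_mkcond; apply: eq_bigr => l _; rewrite !mxE Q_monom [killing _ e`_j]killingC.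
set q := killing _ _; case: ltnP => [_|rl]; last first.
  by rewrite (nth_default _ rl) coef0 mul0r scale0r.
rewrite double_nat_sum.
transitivity (\sum_(k < size (r i j)`_l) if (k : nat) == m then ((r i j)`_l`_m * q) *: e`_i
  else 0).
  apply: eq_bigr => k _.
  have -> : (((r i j)`_l`_k * q) *: diag_embed (monom e`_i k)).1 m =
    ((r i j)`_l`_k * q) *: (if m%:Z == k%:Z then e`_i else 0) by [].
  by rewrite eqz_nat eq_sym; case: eqP => [->|_]; rewrite ?scaler0.
have [mr|rm] := ltnP m (size ((r i j)`_l)%R).
  by rewrite -big_mkcond (big_pred1 (Ordinal mr)).
by rewrite (nth_default _ rm) mul0r scale0r big1 => // k _; case: eqP.
Qed.

End PolynomialKernels.

(** * Pairing the Yang-Baxter equation with three vectors *)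

Section Correspondence.
Variables (F : numFieldType) (g : lieAlgType F).
Local Notation n := (\dim {:g}).
Local Notation e := (vbasis {:g}).
Local Notation e_basis := (vbasisP {:g}).
Implicit Types (s t : tensor2 g) (x y : g).

Definition pair3 (T : tensor3 g) (y1 y2 y3 : g) : F :=
  \sum_(i < n) \sum_(j < n) \sum_(k < n) killing e`_i y1 * killing e`_j y2 * killing e`_k
    y3 * (T (i, j, k) : F).

Lemma pair3P c T T' y1 y2 y3 :
  pair3 (c *: T + T') y1 y2 y3 = c * pair3 T y1 y2 y3 + pair3 T' y1 y2 y3.
Proof.
rewrite /pair3 [in RHS]mulr_sumr -big_split; apply: eq_bigr => i _ /=.
rewrite [in RHS]mulr_sumr -big_split; apply: eq_bigr => j _ /=.
rewrite [in RHS]mulr_sumr -big_split; apply: eq_bigr => k _ /=.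
by rewrite !ffunE /GRing.scale/=; ring.
Qed.

Lemma pair3_0 y1 y2 y3 : pair3 0 y1 y2 y3 = 0.
Proof. by do 3![rewrite /pair3 big1// => ? _]; rewrite ffunE mulr0. Qed.

Lemma pair3D T T' y1 y2 y3 : pair3 (T + T') y1 y2 y3 = pair3 T y1 y2 y3 + pair3 T' y1 y2 y3.
Proof. by rewrite -[T]scale1r pair3P mul1r scale1r. Qed.

Lemma pair3Z c T y1 y2 y3 : pair3 (c *: T) y1 y2 y3 = c * pair3 T y1 y2 y3.
Proof. by rewrite -[c *: T]addr0 pair3P pair3_0 addr0. Qed.

Lemma pair3_sum (I : Type) (r : seq I) (Pr : pred I) (T : I -> tensor3 g) y1 y2 y3 :
  pair3 (\sum_(i <- r | Pr i) T i) y1 y2 y3 = \sum_(i <- r | Pr i) pair3 (T i) y1 y2 y3.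
Proof.
apply: (big_morph (fun T => pair3 T y1 y2 y3)) => [T1 T2|]; first exact: pair3D.
exact: pair3_0.
Qed.

Lemma sum3_distr (a b c a' b' c' : 'I_n -> F) :
  \sum_i \sum_j \sum_k a i * b j * c k * (a' i * b' j * c' k) =
  (\sum_i a' i * a i) * (\sum_i b' i * b i) * (\sum_i c' i * c i).
Proof.
rewrite -mulrA mulr_suml; apply: eq_bigr => i _.
rewrite mulr_suml mulr_sumr; apply: eq_bigr => j _.
rewrite !mulr_sumr; apply: eq_bigr => k _.
by ring.
Qed.

Lemma pair3_tens3 x1 x2 x3 y1 y2 y3 :
  pair3 (tens3 x1 x2 x3) y1 y2 y3 = killing x1 y1 * killing x2 y2 * killing x3 y3.
Proof.
have kE x y : killing x y = \sum_i coord e i x * killing e`_i y.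
  rewrite {1}(coord_basis e_basis (memvf x)) killing_suml.
  by apply: eq_bigr => i _; rewrite killingZl.
rewrite !kE /pair3.
under eq_bigr do under eq_bigr do under eq_bigr do rewrite ffunE /=.
exact: (sum3_distr (fun i => killing e`_i y1) (fun i => killing e`_i y2)
  (fun i => killing e`_i y3) (coord e ^~ x1) (coord e ^~ x2) (coord e ^~ x3)).
Qed.

Lemma contract_tr s y : contract s^T y = \sum_i \sum_j (s i j * killing e`_i y) *: e`_j.
Proof.
rewrite /contract exchange_big; apply: eq_bigr => i _; apply: eq_bigr => j _.
by rewrite mxE.
Qed.

Lemma lie_sum2 (a b : 'I_n -> 'I_n -> F) (x y : 'I_n -> 'I_n -> g) z :
  killing (lie (\sum_i \sum_j a i j *: x i j) (\sum_i \sum_j b i j *: y i j)) z =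
  \sum_i \sum_j \sum_k \sum_l a i j * b k l * killing (lie (x i j) (y k l)) z.
Proof.
rewrite lie_suml killing_suml; apply: eq_bigr => i _.
rewrite lie_suml killing_suml; apply: eq_bigr => j _.
rewrite linear_sum killing_suml; apply: eq_bigr => k _ /=.
rewrite linear_sum killing_suml; apply: eq_bigr => l _ /=.
by rewrite lieZl linearZ/= !killingZl mulrA.
Qed.

(** The leg shared by s and t carries the bracket; the other two are contracted, through a transpose
    when the free leg is the first (as in the next two lemmas). *)
Lemma pair3_lie12_13 s t y1 y2 y3 :
  pair3 (lie12_13 s t) y1 y2 y3 = killing (lie (contract s y2) (contract t y3)) y1.
Proof.
rewrite lie_sum2 pair3_sum; apply: eq_bigr => i _.
rewrite pair3_sum; apply: eq_bigr => j _.
rewrite pair3_sum; apply: eq_bigr => k _.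
rewrite pair3_sum; apply: eq_bigr => l _.
by rewrite pair3Z pair3_tens3; ring.
Qed.

Lemma pair3_lie12_23 s t y1 y2 y3 :
  pair3 (lie12_23 s t) y1 y2 y3 = killing (lie (contract s^T y1) (contract t y3)) y2.
Proof.
rewrite contract_tr lie_sum2 pair3_sum; apply: eq_bigr => i _.
rewrite pair3_sum; apply: eq_bigr => j _.
rewrite pair3_sum; apply: eq_bigr => k _.
rewrite pair3_sum; apply: eq_bigr => l _.
by rewrite pair3Z pair3_tens3; ring.
Qed.

Lemma pair3_lie13_23 s t y1 y2 y3 :
  pair3 (lie13_23 s t) y1 y2 y3 = killing (lie (contract s^T y1) (contract t^T y2)) y3.
Proof.
rewrite !contract_tr lie_sum2 pair3_sum; apply: eq_bigr => i _.
rewrite pair3_sum; apply: eq_bigr => j _.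
rewrite pair3_sum; apply: eq_bigr => k _.
rewrite pair3_sum; apply: eq_bigr => l _.
by rewrite pair3Z pair3_tens3; ring.
Qed.

Hypothesis K_nondeg : killing_nondeg g.

Lemma pair3_eq0 (T : tensor3 g) : (forall y1 y2 y3, pair3 T y1 y2 y3 = 0) -> T = 0.
Proof.
move=> T0; apply/ffunP => -[[a b] c]; rewrite ffunE.
rewrite -(T0 (dual_basis a) (dual_basis b) (dual_basis c)) /pair3.
rewrite (bigD1 a)//= [X in _ + X]big1 ?addr0 => [|i ia]; last first.
  by rewrite big1// => j _; rewrite big1// => k _;
    rewrite killing_dual_basis// (negPf ia) !mul0r.
rewrite (bigD1 b)//= [X in _ + X]big1 ?addr0 => [|j jb]; last first.
  by rewrite big1// => k _; rewrite !killing_dual_basis// (negPf jb) mulr0 !mul0r.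
rewrite (bigD1 c)//= [X in _ + X]big1 ?addr0 => [|k kc]; last first.
  by rewrite !killing_dual_basis// (negPf kc) mulr0 mul0r.
by rewrite !killing_dual_basis// !eqxx !mul1r.
Qed.

Section Kernel.
Variables (P : nat -> nat -> tensor2 g) (d : nat).
Hypothesis P_bound : forall k l, (d <= k)%N || (d <= l)%N -> P k l = 0.
Local Notation X := (kfun P d).
Local Notation W := (Wker P d).

Lemma skew_eval_vec u v : u != v ->
  (X u v = - (X v u)^T) <-> forall x y, Q (eval_vec P_bound u x) (eval_vec P_bound v y) = 0.
Proof.
move=> uv; have QE x y : Q (eval_vec P_bound u x) (eval_vec P_bound v y) =
    killing x (contract (X u v + (X v u)^T) y).
  by rewrite Q_eval_vec// contractDl killingDr -killing_contract.
split=> [Xuv x y|Q0]; first by rewrite QE Xuv addNr contract0l killing0r.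
apply/eqP; rewrite -addr_eq0; apply/eqP; apply: contract_inj => // y.
by rewrite contract0l; apply: K_nondeg => x; rewrite killingC -QE.
Qed.

(** [Q_lie_eval_vec] has X at all ordered pairs of points, the equation only at (u_i, u_j) with i <
    j, with transposes; skew-symmetry converts one into the other. *)
Lemma pair3_CYBE u1 u2 u3 y1 y2 y3 : u1 != u2 -> u1 != u3 -> u2 != u3 ->
  (forall u v, u != v -> X u v = - (X v u)^T) ->
  pair3 (lie12_13 (X u1 u2) (X u1 u3) + lie12_23 (X u1 u2) (X u2 u3)
         + lie13_23 (X u1 u3) (X u2 u3)) y1 y2 y3 =
  Q (double_lie (eval_vec P_bound u1 y1) (eval_vec P_bound u2 y2)) (eval_vec P_bound u3 y3).
Proof.
move=> u12 u13 u23 skew; rewrite Q_lie_eval_vec// !pair3D pair3_lie12_13 pair3_lie12_23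
  pair3_lie13_23.
have skewT u v : u != v -> (X u v)^T = - X v u.
  by move=> uv; rewrite (skew v u) 1?eq_sym// opprK.
rewrite !skewT// !contractNl !lieNl !linearN/= !opprK.
by rewrite killingNl.
Qed.

Lemma CYBE_Wker : CYBE X <->
  isotropic W /\ (forall w z, W w -> W z -> W (double_lie w z)).
Proof.
split=> [[cybe skew]|[iso closed]].
  have iso : isotropic W.
    apply: (eval_vec_isotropic (P_bound := P_bound)) => u v x y uv.
    by apply: (skew_eval_vec uv).1; exact: skew.
  split=> //; apply: (eval_vec_lie_closed (P_bound := P_bound)) => // u1 u2 u3 y1 y2 y3 u12
    u13 u23.
  by rewrite -pair3_CYBE// cybe// pair3_0.
have skew u v : u != v -> X u v = - (X v u)^T.
  by move=> uv; apply/(skew_eval_vec uv) => x y; apply: iso; exact: Wker_graph_vec.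
split=> // u1 u2 u3 u12 u13 u23; apply: pair3_eq0 => y1 y2 y3.
rewrite pair3_CYBE//; apply: iso; last exact: Wker_graph_vec.
by apply: closed; exact: Wker_graph_vec.
Qed.

End Kernel.

End Correspondence.

(** * The correspondence *)

Section Reconstruction.
Variables (F : numFieldType) (g : lieAlgType F).
Local Notation n := (\dim {:g}).
Local Notation e := (vbasis {:g}).
Local Notation D := (loop_double g).
Implicit Types (w z : D) (x y : g).
Hypothesis K_nondeg : killing_nondeg g.

(** The element of W with y concentrated at index l has [contract (P k l) y] as its coefficient of
    u^k. *)
Lemma Wker_inj (P P' : nat -> nat -> tensor2 g) d k l :
  (forall k l, (d <= k)%N || (d <= l)%N -> P k l = 0) ->
  (forall k l, (d <= k)%N || (d <= l)%N -> P' k l = 0) ->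
  Wker P d = Wker P' d -> P k l = P' k l.
Proof.
move=> Pd P'd WW; have [dl|ld] := leqP d l; first by rewrite Pd ?P'd ?dl ?orbT.
apply: contract_inj => // y; pose f m := if m == l then y else 0.
have kactE (S : nat -> nat -> tensor2 g) : kact S d f k = contract (S k l) y.
  rewrite /kact (bigD1 (Ordinal ld))//= /f eqxx big1 ?addr0// => m ml.
  by rewrite ifN ?linear0.
have := Wker_graph_vec Pd f; rewrite WW => /(_ k); rewrite graph_vec_nat kactE => ->.
by rewrite -kactE; apply: eq_kact => m; rewrite pole_graph_vec.
Qed.

Lemma submod_closedP (W : set D) : submod_closed [in W] ->
  W 0 /\ forall c w z, W w -> W z -> W (c *: w + z).
Proof.
move=> [W0 WP]; split=> [|c w z wW zW]; first by move: W0; rewrite inE.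
by have := WP c w z; rewrite !inE; apply.
Qed.

Lemma submod_sum (W : set D) (I : Type) (s : seq I) (Pr : pred I) (u : I -> D) :
  submod_closed [in W] -> (forall i, Pr i -> W (u i)) -> W (\sum_(i <- s | Pr i) u i).
Proof.
move=> /submod_closedP[W0 WP] uW; apply: (big_ind (fun w => W w)) => // w z wW zW.
by rewrite -[w]scale1r; exact: WP.
Qed.

Lemma pole_coef_sum (I : Type) (s : seq I) (Pr : pred I) (u : I -> D) k :
  pole_coef (\sum_(i <- s | Pr i) u i) k = \sum_(i <- s | Pr i) pole_coef (u i) k.
Proof.
apply: (big_morph (fun w => pole_coef w k)) => [w z|]; first exact: pole_coefD.
by apply: (V0P _).1; exact: V0_0.
Qed.

Lemma pole_coefZ c w k : pole_coef (c *: w) k = c *: pole_coef w k.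
Proof.
rewrite -[c *: w]addr0 pole_coefP [X in _ + X](V0P _).1 ?addr0//.
by exact: V0_0.
Qed.

Lemma tail_pole N w : (0 < N)%N -> (forall k : nat, w.1 k = 0) ->
  (forall k, (k < N)%N -> pole_coef w k = 0) -> tail N w.
Proof.
move=> N0 w0 wp; split=> [[k|k] Nk|].
- exact: w0.
- by rewrite -pole_coefS wp//; lia.
- by have := wp 0%N N0; rewrite pole_coef0 w0 sub0r => /eqP; rewrite oppr_eq0 => /eqP.
Qed.

(* P is read off the elements of W whose pairings with V0 are the coordinate
   functionals; only finitely many matter since W contains a tail. *)
Lemma Wker_ex (W : set D) (N : nat) : submod_closed [in W] -> (0 < N)%N ->
  tail N `<=` W -> complementary W V0 ->
  exists d (P : nat -> nat -> tensor2 g),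
    (forall k l, (d <= k)%N || (d <= l)%N -> P k l = 0) /\ W = Wker P d.
Proof.
move=> Wsub N0 tW [WV0 WV]; have [W0 WP] := submod_closedP Wsub.
have /choice[om omP] : forall lj : nat * 'I_n, exists w, W w /\
    forall m, pole_coef w m = if m == lj.1 then e`_lj.2 else 0.
  move=> [l j]; have : setT (polar (fun m => if m == l then e`_j else 0) : D) by [].
  rewrite -WV => -[w wW [v /V0P v0 wvE]]; exists w; split=> // m.
  have := congr1 (fun z : D => pole_coef z m) wvE.
  by rewrite /= pole_coefD v0 addr0 pole_polar.
have /choice[b bP] : forall lj, exists b, deg_le (om lj) b by move=> lj; exact: deg_le_ex.
(* d bounds N and exceeds the degrees of all [om (l, j)] with l < N. *)
pose d := (N + \sum_(l < N) \sum_j b (nat_of_ord l, j)).+1.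
have Nd : (N <= d)%N by rewrite /d leqW// leq_addr.
have degd l j : (l < N)%N -> deg_le (om (l, j)) d.-1.
  move=> lN; apply: deg_leW (bP (l, j)); rewrite /d /= (bigD1 (Ordinal lN))//=.
  by rewrite (bigD1 j)//= addnCA -!addnA leq_addr.
(* For l >= N the kernel is zero, because polar vectors concentrated at such an index lie in the
   tail. *)
pose P k l : tensor2 g :=
  if (k < d)%N && (l < N)%N then \sum_j tens2 ((om (l, j)).1 k%:Z) (dual_basis j) else 0.
have Pd k l : (d <= k)%N || (d <= l)%N -> P k l = 0.
  rewrite /P; case: ifP => // /andP[kd lN]; rewrite leqNgt kd/= => dl.
  by move: lN; rewrite ltnNge (leq_trans Nd dl).
have PE k l y : (l < N)%N -> contract (P k l) y =
    \sum_j killing (dual_basis j) y *: (om (l, j)).1 k%:Z.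
  move=> lN; rewrite /P lN andbT; case: ltnP => [kd|dk].
    by rewrite contract_suml; apply: eq_bigr => j _; rewrite contract_tens2.
  rewrite contract0l big1// => j _; rewrite (degd _ _ lN) ?scaler0//.
(* The graph vector differs from the finite combination s of the [om (l, j)] by an element of the
   tail. *)
have graph_vecW (y : nat -> g) : W (graph_vec Pd y).
  pose s := \sum_(l < N) \sum_j killing (dual_basis j) (y l) *: om (nat_of_ord l, j).
  have sW : W s.
    apply: submod_sum => // l _; apply: submod_sum => // j _.
    by rewrite -[_ *: _]addr0; apply: WP W0; case: (omP (nat_of_ord l, j)).
  rewrite -[graph_vec Pd y](subrK s) -[_ - s]scale1r; apply: WP => //; apply: tW.
  apply: tail_pole => // k => [|kN].
    have -> : (graph_vec Pd y - s).1 k%:Z = kact P d y k - s.1 k%:Z by rewrite -graph_vec_nat.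
    apply/eqP; rewrite subr_eq0; apply/eqP; rewrite double_nat_sum /kact.
    rewrite [RHS](big_ord_widen d (fun l => (\sum_j killing (dual_basis j) (y l) *: om (l,
      j)).1 k%:Z))//.
    rewrite [RHS]big_mkcond/=; apply: eq_bigr => l _; case: ltnP => [lN|Nl].
      by rewrite PE// double_nat_sum.
    by rewrite /P [(l < N)%N]ltnNge Nl andbF contract0l.
  rewrite pole_coefB pole_graph_vec pole_coef_sum (bigD1 (Ordinal kN))//= [X in _ - (_ +
    X)]big1 ?addr0.
    rewrite pole_coef_sum -[X in X - _](sum_dual_basis K_nondeg (y k)) -sumrB big1// => j _.
    by rewrite pole_coefZ (omP (k, j)).2 eqxx subrr.
  move=> l lk; rewrite pole_coef_sum big1// => j _.
  by rewrite pole_coefZ (omP _).2 ifN ?scaler0// eq_sym.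
exists d, P; split=> //; apply/seteqP; split=> [w wW|w wW]; last by rewrite (WkerP Pd wW).
(* Conversely, w and the graph vector with the same pole coefficients are both in W and differ by an
   element of V0. *)
have : (W `&` V0) (w - graph_vec Pd (pole_coef w)).
  split; first by rewrite addrC -scaleN1r; exact: WP.
  by apply/V0P => k; rewrite pole_coefB pole_graph_vec subrr.
rewrite WV0 => /eqP; rewrite subr_eq0 => /eqP ->; exact: Wker_graph_vec.
Qed.

End Reconstruction.

Section Main.
Variables (F : numFieldType) (g : lieAlgType F) (H : {vspace g}).
Variables (pos : seq (cartan_dual H)) (ev : cartan_dual H -> g).
Hypotheses (g_simple : simple_lie g) (H_cartan : cartan_subalgebra H).
Hypotheses (pos_positive : positive_system pos) (e_root : root_vectors ev).
Local Notation D := (loop_double g).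
Implicit Types (p : tpoly g) (w z : D).

Let Kn := killing_nondeg_roots H_cartan g_simple e_root.
Let cst (t : tensor2 g) : tpoly g := map_mx (fun c : F => c%:P%:P) t.

Lemma W0_nat w : W0 pos w <-> forall k : nat,
  w.1 k = if k == 0%N then contract (r0 pos ev) (pole_coef w 0) else 0.
Proof.
rewrite (W0P g_simple H_cartan pos_positive e_root) pole_coef0.
split=> [[w0 wE] [|k]|wE]; first exact: wE.
- exact: w0.
- by split=> [[[|k]|k]|] //; exact: (wE 0%N).
Qed.

Lemma tbound_subC p (t : tensor2 g) d : (0 < d)%N -> tbound p d -> tbound (p - cst t) d.
Proof.
move=> d0 pd i j; rewrite !mxE; have [p1 p2] := pd i j; split=> [|l].
  rewrite (leq_trans (size_polyD _ _))// geq_max p1 size_polyN.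
  exact: leq_trans (size_polyC_leq1 _) d0.
rewrite coefB coefC (leq_trans (size_polyD _ _))// geq_max p2 size_polyN.
by case: eqP => _; rewrite ?size_poly0// (leq_trans (size_polyC_leq1 _) d0).
Qed.

Lemma tcoef_subC p (t : tensor2 g) k l :
  tcoef (p - cst t) k l = tcoef p k l - (if (k == 0%N) && (l == 0%N) then t else 0).
Proof.
apply/matrixP => i j; rewrite !mxE !coefB coefC; congr (_ - _).
by have [_|_] := eqVneq l 0%N; rewrite ?andbF ?andbT ?coefC ?coef0; case: ifP => _;
  rewrite ?mxE.
Qed.

(** A positive d bounds the constant tensor r0 along with p, so one bound serves for p - r0. *)
Lemma W_ofE p d : (0 < d)%N -> tbound p d ->
  W_of pos ev (quasi_trig p) = Wker (tcoef p) d.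
Proof.
move=> d0 pd; rewrite /W_of poly_partK.
set r := p - _; have rd : tbound r d by exact: tbound_subC.
have PhiE w (k : nat) : (Phi r w).1 k = kact (tcoef p) d (pole_coef w) k
    - (if k == 0%N then contract (r0 pos ev) (pole_coef w 0) else 0).
  rewrite (Phi_nat _ _ rd) /kact.
  under eq_bigr do rewrite tcoef_subC contractDl contractNl.
  rewrite sumrB; congr (_ - _); rewrite (bigD1 (Ordinal d0))//= big1 => [|l l0].
    by rewrite andbT addr0; case: eqP => _; rewrite ?contract0l.
  by rewrite -val_eqE/= in l0; rewrite (negPf l0) andbF contract0l.
have poleE w : pole_coef (w + Phi r w) =1 pole_coef w.
  by move=> k; rewrite pole_coefD [X in _ + X](V0P _).1 ?addr0//; exact: V0_Phi.
apply/seteqP; split=> [_ [w /W0_nat w0 <-] k|w wW].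
  have -> : (w + Phi r w).1 k = w.1 k + (Phi r w).1 k by [].
  by rewrite w0 PhiE addrC subrK; apply: eq_kact => l; rewrite poleE.
(* Phi has values in V0 and depends on pole coefficients only, so it takes the same value at w and
   at [w - Phi r w]. *)
exists (w - Phi r w).
  apply/W0_nat => k; have -> : (w - Phi r w).1 k = w.1 k - (Phi r w).1 k by [].
  rewrite PhiE wW opprB addrCA subrr addr0 pole_coefB [pole_coef (Phi _ _) _](V0P _).1 ?subr0//.
  exact: V0_Phi.
suff -> : Phi r (w - Phi r w) = Phi r w by rewrite subrK.
have Vp z : pole_coef (Phi r z) =1 fun=> 0 by apply: (V0P _).1; exact: V0_Phi.
apply: double_pole_eqP => k; last by rewrite !Vp.
by rewrite !(Phi_nat _ _ rd); apply: eq_kact => l; rewrite pole_coefB Vp subr0.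
Qed.

Lemma quasi_trig_ex (P : nat -> nat -> tensor2 g) d :
  (forall k l, (d <= k)%N || (d <= l)%N -> P k l = 0) ->
  exists p, tbound p d /\ tcoef p = P.
Proof.
move=> Pd; exists (\matrix_(i, j) \poly_(l < d) \poly_(k < d) P k l i j); split=> [i j|].
  rewrite mxE; split=> [|l]; first exact: size_poly.
  by rewrite coef_poly; case: ifP => _; rewrite ?size_poly ?size_poly0.
apply/funext => k; apply/funext => l; apply/matrixP => i j; rewrite !mxE coef_poly.
case: ltnP => [_|dl]; last by rewrite coef0 Pd ?dl ?orbT// mxE.
by rewrite coef_poly; case: ltnP => // dk; rewrite Pd ?dk// mxE.
Qed.

Theorem quasi_trig_lagrangian_bij :
  set_bij
    [set X : F -> F -> tensor2 g | quasi_trig_solution X]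
    [set W : set D |
      [/\ lie_subalgebra W /\ (exists2 N : nat, (0 < N)%N & tail N `<=` W),
          complementary W V0
        & lagrangian W]]
    (W_of pos ev).
Proof.
split=> [X [[p ->] cybe]|X X'|W [[[Wsub Wlie] [N N0 tW]] Wc Wl]].
- have [d /(tboundW (leqnSn d)) pd] := tbound_ex p.
  have Pd := tcoef_bound pd; rewrite /= (W_ofE _ pd)//.
  rewrite (quasi_trigE pd) in cybe; have [iso closed] := (CYBE_Wker Kn Pd).1 cybe.
  split; last exact: isotropic_lagrangian.
    split; first by split=> //; exact: Wker_submod.
    (* The bound in use is [d.+1], and the tail must start beyond it. *)
    by exists d.+2 => //; exact: tail_Wker.
  exact: complementary_Wker.
- rewrite !inE => -[[p ->] _] [[p' ->] _].
  have [d pd] := tbound_ex p; have [d' pd'] := tbound_ex p'; pose m := (maxn d d').+1.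
  have pm : tbound p m by apply: tboundW pd; rewrite leqW// leq_maxl.
  have pm' : tbound p' m by apply: tboundW pd'; rewrite leqW// leq_maxr.
  rewrite (W_ofE _ pm)// (W_ofE _ pm')// => WW.
  rewrite (quasi_trigE pm) (quasi_trigE pm'); congr kfun.
  apply/funext => k; apply/funext => l.
  exact: (Wker_inj Kn _ _ (tcoef_bound pm) (tcoef_bound pm') WW).
- have [d [P [Pd WE]]] := Wker_ex Kn Wsub N0 tW Wc.
  have [p [pd pP]] := quasi_trig_ex Pd.
  have W_ofW : W_of pos ev (quasi_trig p) = W.
    (* d is not known to be positive here; raising it by one adds only zero terms to the kernel. *)
    have d0 : (0 < d.+1)%N by [].
    have pd1 := tboundW (leqnSn d) pd.
    rewrite (W_ofE d0 pd1) WE pP; apply/seteqP; rewrite /Wker/=.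
    have kE y k : kact P d.+1 y k = kact P d y k.
      by rewrite /kact big_ord_recr/= Pd ?leqnn ?orbT// contract0l addr0.
    by split=> w wW k; have := wW k; rewrite kE.
  exists (quasi_trig p) => //=; split; first by exists p.
  rewrite (quasi_trigE pd) pP; apply/(CYBE_Wker Kn Pd); rewrite -WE; split=> // w z wW zW.
  by move: wW; rewrite {1}Wl; apply.
Qed.

End Main.

Theorem theorem3p8 (R : realType) (g : lieAlgType R[i])
    (H : {vspace g}) (pos : seq (cartan_dual H)) (e : cartan_dual H -> g)
    (g_simple : simple_lie g)
    (H_cartan : cartan_subalgebra H)
    (pos_positive : positive_system pos)
    (e_root : root_vectors e) :
  set_bij
    [set X : R[i] -> R[i] -> tensor2 g | quasi_trig_solution X]
    [set W : set (loop_double g) |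
      [/\ lie_subalgebra W /\ (exists2 N : nat, (0 < N)%N & tail N `<=` W),
          complementary W V0
        & lagrangian W]]
    (W_of pos e).
Proof. exact: quasi_trig_lagrangian_bij. Qed.
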